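(* Let $k=\bar{\mathbf F}_2$ and let $E$ be an elliptic curve defined over $k$, with identity element $0_E$. The following conditions are equivalent: (1) there exists a Lamé point $P\in E(k)$; (2) any element of $E(k)-\{0_E\}$ is a Lamé point; (3) the curve $E$ is supersingular. If condition (1) (or (2)) is fulfilled, then the signature (of $(E,P)$, for every Lamé point $P\in E(k)$) is always equal to $1$.
   Context: Let $E$ be an elliptic curve over an algebraically closed field $k$ of characteristic $\neq 3$, with identity $0_E$, and let $P\in E(k)$ be a torsion point of exact order $n>1$, with $n$ not divisible by the characteristic of $k$. There is a rational function $f_P\in k(E)$, unique up to a multiplicative constant, with divisor $n(P)-n(0_E)$; it induces a degree $n$ cover $f_P:E\to\mathbf P^1_k$. The point $P$ is called a Lamé point (of order $n$), and the pair $(E,P)$ a Lamé curve of order $n$, if $f_P$ is tamely ramified and is ramified exactly at $0_E$ and $P$, with ramification index $n$, and at one third point $Q$, with ramification index $3$. In this case $2Q=P$ in the group $E(k)$, and the signature of $(E,P)$ is defined to be $1$ if $Q$ has order $n$ and $0$ if $Q$ has order $2n$. *)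

(* Defs.v *)
From HB Require Import structures.
From mathcomp Require Import all_boot all_order all_algebra all_field.
From mathcomp Require Import ring zify.

Set Implicit Arguments.
Unset Strict Implicit.
Unset Printing Implicit Defensive.

Import GRing.Theory.
Local Open Scope ring_scope.

(* y^2 + a1 x y + a3 y = x^3 + a2 x^2 + a4 x + a6 *)
Record weierstrass (k : fieldType) := Weierstrass {
  a1 : k; a2 : k; a3 : k; a4 : k; a6 : k }.

Section Discriminant.
Variables (k : fieldType) (W : weierstrass k).

Definition b2 := (a1 W) ^+ 2 + 4%:R * a2 W.
Definition b4 := 2%:R * a4 W + a1 W * a3 W.
Definition b6 := (a3 W) ^+ 2 + 4%:R * a6 W.
Definition b8 := (a1 W) ^+ 2 * a6 W + 4%:R * a2 W * a6 W
  - a1 W * a3 W * a4 W + a2 W * (a3 W) ^+ 2 - (a4 W) ^+ 2.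
Definition discriminant :=
  - b2 ^+ 2 * b8 - 8%:R * b4 ^+ 3 - 27%:R * b6 ^+ 2 + 9%:R * b2 * b4 * b6.

End Discriminant.

Record ellcurve (k : fieldType) := EllCurve {
  weq :> weierstrass k;
  weq_smooth : discriminant weq != 0 }.

Section Points.
Variables (k : fieldType) (W : weierstrass k).

(* None is the point at infinity (0 : 1 : 0). *)
Definition on_curve (p : option (k * k)) : bool :=
  if p is Some (x, y) then
    y ^+ 2 + a1 W * x * y + a3 W * y
      == x ^+ 3 + a2 W * x ^+ 2 + a4 W * x + a6 W
  else true.

Record point := Point { coords :> option (k * k); _ : on_curve coords }.

HB.instance Definition _ := [isSub for coords].
HB.instance Definition _ := [Choice of point by <:].

Definition pt0 : point := @Point None isT.

Definition chord_slope (x1 y1 x2 y2 : k) : k :=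
  if x1 == x2 then
    (3%:R * x1 ^+ 2 + 2%:R * a2 W * x1 + a4 W - a1 W * y1)
      / (2%:R * y1 + a1 W * x1 + a3 W)
  else (y2 - y1) / (x2 - x1).

Definition add_coords (p q : option (k * k)) : option (k * k) :=
  match p, q with
  | None, _ => q
  | _, None => p
  | Some (x1, y1), Some (x2, y2) =>
      if (x1 == x2) && (y1 + y2 + a1 W * x2 + a3 W == 0) then None else
      let l := chord_slope x1 y1 x2 y2 in
      let x3 := l ^+ 2 + a1 W * l - a2 W - x1 - x2 in
      Some (x3, - (l * (x3 - x1) + y1) - a1 W * x3 - a3 W)
  end.

Lemma add_on_curve (P Q : point) : on_curve (add_coords P Q).
Proof.
case: P Q => [[[x1 y1]|] HP] [[[x2 y2]|] HQ] //=.
case: ifP => // ndiag.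
move: HP HQ => /= /eqP HP /eqP HQ.
set l := chord_slope _ _ _ _; set x3 := l ^+ 2 + _ - _ - _ - _.
(* the line through the two points meets the curve at x1 and at the roots of
   the quadratic polynomial whose value at x2 is the following expression *)
have Q2 : x2 ^+ 2 + x2 * x1 + x1 ^+ 2 + a2 W * (x2 + x1) + a4 W
    - l * (2%:R * y1 + l * (x2 - x1)) - a1 W * (y1 + l * x2) - a3 W * l = 0.
  rewrite {}/x3 {}/l /chord_slope.
  case: (eqVneq x1 x2) ndiag => [x12 /= /negbT nz | nx _].
    subst x2.
    have yE : y1 = y2.
      have : (y1 - y2) * (y1 + y2 + a1 W * x1 + a3 W) = 0.
        have /eqP := etrans HP (esym HQ); rewrite -subr_eq0 => /eqP <-; ring.
      by move/eqP; rewrite mulf_eq0 (negPf nz) orbF subr_eq0 => /eqP.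
    rewrite -yE in nz.
    have nz' : 2%:R * y1 + a1 W * x1 + a3 W != 0.
      by apply: contraNneq nz => <-; apply/eqP; ring.
    by field.
  have d : x2 - x1 != 0 by rewrite subr_eq0 eq_sym.
  apply: (mulfI d); rewrite mulr0.
  set m := _ / _.
  have my : m * (x2 - x1) = y2 - y1 by rewrite /m divfK.
  have y2E : y2 = y1 + m * (x2 - x1) by rewrite my; ring.
  move: HP HQ => /eqP; rewrite -subr_eq0 => /eqP HP /eqP.
  rewrite -subr_eq0 => /eqP HQ.
  have <- : 0 - 0 = 0 :> k by ring.
  by rewrite -{1}HP -{1}HQ y2E; ring.
rewrite -subr_eq0; apply/eqP.
move: HP => /eqP; rewrite -subr_eq0 => /eqP HP.
transitivity ((y1 ^+ 2 + a1 W * x1 * y1 + a3 W * y1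
   - (x1 ^+ 3 + a2 W * x1 ^+ 2 + a4 W * x1 + a6 W))
   - (x3 - x1) * (x2 ^+ 2 + x2 * x1 + x1 ^+ 2 + a2 W * (x2 + x1) + a4 W
    - l * (2%:R * y1 + l * (x2 - x1)) - a1 W * (y1 + l * x2) - a3 W * l)).
  rewrite /x3; ring.
by rewrite HP Q2 mulr0 subr0.
Qed.

Definition add_pt (P Q : point) : point := Point (add_on_curve P Q).

Definition mul_pt (n : nat) (P : point) : point := iter n (add_pt P) pt0.

Definition exact_order (P : point) (n : nat) : Prop :=
  [/\ (0 < n)%N, mul_pt n P = pt0
    & forall m, (0 < m < n)%N -> mul_pt m P <> pt0].

(* E[p](k) = 0; this is the usual notion only when k is algebraically closed. *)
Definition supersingular : Prop :=
  exists2 p, p \in [pchar k] & forall P, mul_pt p P = pt0 -> P = pt0.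

End Points.

Section FractionNumden.
Import FracField.
Local Open Scope quotient_scope.

Lemma fraction_numden (R : idomainType) (r : {fraction R}) :
  exists u v : R, v != 0 /\ r = tofrac u / tofrac v.
Proof.
elim/quotW: r => x; exists \n_x, \d_x; split; first exact: denom_ratioP.
have nv : tofrac \d_x != 0 by rewrite tofrac_eq0 denom_ratioP.
apply: (canRL (mulfK nv)).
unlock tofrac; rewrite -[LHS]pi_mul; apply/eqmodP.
rewrite /= equivfE /mulf !numden_Ratio ?mulr1 ?oner_eq0 ?denom_ratioP //.
by rewrite mulrC.
Qed.

End FractionNumden.

Lemma clear_denominator (F : fieldType) (u v l c : F) : v != 0 ->
  root ('X^2 + l%:P * 'X - c%:P) (u / v) -> u ^+ 2 + l * u * v = c * v ^+ 2.
Proof.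
rewrite rootE hornerD hornerN hornerD hornerXn hornerM !hornerC hornerX.
move=> nv /eqP e; apply/eqP; rewrite -subr_eq0; apply/eqP.
by rewrite -[RHS](mulr0 (v ^+ 2)) -e; field.
Qed.

Section FunctionField.
Variables (k : fieldType) (W : weierstrass k).

Local Notation kx := {fraction {poly k}}.

Definition weq_lin : {poly k} := a1 W *: 'X + (a3 W)%:P.
Definition weq_cub : {poly k} :=
  'X^3 + a2 W *: 'X^2 + a4 W *: 'X + (a6 W)%:P.

Definition weq_poly : {poly kx} :=
  'X^2 + (tofrac weq_lin)%:P * 'X - (tofrac weq_cub)%:P.

Lemma size_weq_poly : size weq_poly = 3%N.
Proof.
rewrite /weq_poly -addrA size_polyDl size_polyXn //.
apply: leq_ltn_trans (size_polyD _ _) _.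
rewrite gtn_max size_polyN size_polyC mul_polyC.
rewrite (leq_ltn_trans (size_scale_leq _ _)) ?size_polyX //.
by case: eqP.
Qed.

Lemma weq_poly_monic : weq_poly \is monic.
Proof.
rewrite monicE lead_coefE size_weq_poly /weq_poly.
by rewrite coefB coefD coefCM coefXn coefX coefC mulr0 addr0 subr0.
Qed.

Lemma size_weq_cub : size weq_cub = 4%N.
Proof.
rewrite /weq_cub -!addrA size_polyDl size_polyXn //.
have s n c : (n < 3)%N -> (size (c *: 'X^n : {poly k})%R <= 3)%N.
  by move=> n3; rewrite (leq_trans (size_scale_leq _ _)) ?size_polyXn.
rewrite ltnS !(leq_trans (size_polyD _ _)) // geq_max s //=.
rewrite !(leq_trans (size_polyD _ _)) // geq_max (s 1%N) //=.
by rewrite size_polyC; case: eqP.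
Qed.

Lemma weq_poly_noroot (r : kx) : ~~ root weq_poly r.
Proof.
have [u [v [nv ->]]] := fraction_numden r.
have nFv : tofrac v != 0 by rewrite tofrac_eq0.
apply/negP=> e0.
have {e0} : tofrac (u ^+ 2 + weq_lin * u * v) = tofrac (weq_cub * v ^+ 2).
  rewrite tofracD !tofracXn !tofracM; exact: clear_denominator nFv e0.
move/eqP; rewrite tofrac_eq => /eqP e.
have nc : weq_cub != 0 by rewrite -size_poly_eq0 size_weq_cub.
have sv : (0 < size v)%N by rewrite size_poly_gt0.
have sr : size (weq_cub * v ^+ 2) = (3 + (size v + size v)).-1%N.
  rewrite size_mul ?expf_neq0 // size_weq_cub expr2 size_mul //.
  by move: sv; case: (size v) => // n _; rewrite !addnS.
have nu : u != 0.
  apply: contraTneq isT => u0; move: e; rewrite u0 expr0n mulr0 mul0r addr0 /=.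
  by move/esym/eqP; rewrite mulf_eq0 (negPf nc) expf_eq0 (negPf nv).
have su : (0 < size u)%N by rewrite size_poly_gt0.
have s2 : size (u ^+ 2) = (size u + size u).-1%N by rewrite expr2 size_mul.
have sl : (size weq_lin <= 2)%N.
  rewrite (leq_trans (size_polyD _ _)) // geq_max size_polyC.
  rewrite (leq_trans (size_scale_leq _ _)) ?size_polyX //.
  by case: eqP.
have sluv : (size (weq_lin * u * v)%R <= size u + size v)%N.
  have := size_polyMleq weq_lin (u * v); rewrite mulrA (size_mul nu nv); lia.
have szE : size (u ^+ 2 + weq_lin * u * v) = size (weq_cub * v ^+ 2).
  by rewrite e.
rewrite sr in szE.
case: (leqP (size (u ^+ 2)%R) (size (weq_lin * u * v)%R)) => cmp.
  have := size_polyD (u ^+ 2) (weq_lin * u * v).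
  by rewrite szE (maxn_idPr cmp); lia.
by rewrite size_polyDl // s2 in szE; lia.
Qed.

Lemma weq_poly_irr : monic_irreducible_poly weq_poly.
Proof.
split; last exact: weq_poly_monic.
by apply: cubic_irreducible; [rewrite size_weq_poly | exact: weq_poly_noroot].
Qed.

(* k(E) = k(x)[y] / (y^2 + (a1 x + a3) y - (x^3 + a2 x^2 + a4 x + a6)) *)
Definition funfield := {poly %/ weq_poly with weq_poly_irr}.

Definition fconst (c : k) : funfield :=
  qfpoly_const weq_poly_irr (tofrac c%:P).
Definition fx : funfield := qfpoly_const weq_poly_irr (tofrac 'X).
Definition fy : funfield := in_qpoly weq_poly 'X.

(* Affine coordinates near R, as functions and as their values at R. In the
   chart Y != 0 of the projective curve they are X/Y = x/y and Z/Y = 1/y. *)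
Definition loc_fun (R : point W) : funfield * funfield :=
  if coords R is Some _ then (fx, fy) else (fx / fy, fy^-1).
Definition loc_val (R : point W) : k * k :=
  if coords R is Some ab then ab else (0, 0).

Definition eval_fun (R : point W) (p : {poly {poly k}}) : funfield :=
  (map_poly (map_poly fconst) p).[(loc_fun R).1, (loc_fun R).2].
Definition eval_val (R : point W) (p : {poly {poly k}}) : k :=
  p.[(loc_val R).1, (loc_val R).2].

(* f belongs to the local ring O_R and f(R) = c *)
Definition has_value (R : point W) (f : funfield) (c : k) : Prop :=
  exists p q, [/\ eval_val R q != 0, f * eval_fun R q = eval_fun R p
    & c = eval_val R p / eval_val R q].

Definition uniformizer (R : point W) (t : funfield) : Prop :=
  has_value R t 0 /\
  forall g, has_value R g 0 -> exists h c, has_value R h c /\ g = t * h.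

Definition has_ord (R : point W) (f : funfield) (m : int) : Prop :=
  exists t u c,
    [/\ uniformizer R t, has_value R u c, c != 0 & f = t ^ m * u].

Definition has_div (f : funfield) (D : point W -> int) : Prop :=
  forall R, has_ord R f (D R).

(* Ramification index at R of the morphism f : E -> P^1; the second alternative
   is the case f(R) = oo, where 1/f is pulled back from a parameter at oo. *)
Definition ram_index (f : funfield) (R : point W) (e : nat) : Prop :=
  (exists2 c, has_value R f c & has_ord R (f - fconst c) e) \/
  (has_value R f^-1 0 /\ has_ord R f^-1 e).

Definition ramified (f : funfield) (R : point W) : Prop :=
  exists2 e, (1 < e)%N & ram_index f R e.

(* Meaningful for k algebraically closed: every closed point is then a k-point
   with residue field k, and the condition forces f to be separable. *)
Definition tamely_ramified (f : funfield) : Prop :=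
  forall R e p, ram_index f R e -> p \in [pchar k] -> ~~ (p %| e)%N.

(* Q is the point of ramification index 3 *)
Definition lame_triple (P : point W) (n : nat) (Q : point W) : Prop :=
  [/\ (1 < n)%N, exact_order P n, forall p, p \in [pchar k] -> ~~ (p %| n)%N,
      Q <> pt0 W /\ Q <> P
    & exists f : funfield,
      [/\ has_div f (fun R => n%:Z *+ (R == P) - n%:Z *+ (R == pt0 W)),
          tamely_ramified f,
          forall R, ramified f R <-> [\/ R = pt0 W, R = P | R = Q]
        & [/\ ram_index f (pt0 W) n, ram_index f P n & ram_index f Q 3]]].

Definition lame_point (P : point W) : Prop := exists n Q, lame_triple P n Q.

Definition lame_signature (P : point W) (s : nat) : Prop :=
  exists n Q, lame_triple P n Q /\
    ((s = 1%N /\ exact_order Q n) \/ (s = 0%N /\ exact_order Q (2 * n))).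

End FunctionField.

(* Main.v *)
From HB Require Import structures.
Require Import Defs.
From mathcomp Require Import all_boot all_order all_algebra all_field.
From mathcomp Require Import ring zify.

(** Why the theorem is true.  Let k have characteristic 2 and let P <> 0 have odd
    order n, with f a function of divisor n (P) - n (0), and consider the reflection
    z -> P - z of the curve.  The function f(z) f(P - z) has no zeros or poles, so it
    is a constant kappa ([reflection_product]; the proof views the product as a
    polynomial in the slope of the line through - P, z and P - z).  The fixed points
    of the reflection are the halves of P, and f takes at each of them the value
    r = sqrt kappa, which is unique in characteristic 2.  So the fibre f = r contains
    all the fixed points and is stable under the reflection, and counting its n
    points modulo 2 relates ramification to the number of halves of P.

    In the ordinary case there are two halves.  If f were ramified, away from 0 and
    P, at a single point Q, of index 3, then the fibre would consist of an even
    number of points, one of which may count three times: n would be even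
    ([no_lame_ordinary]).

    In the supersingular case a1 = 0, all points have odd order, and P has a single
    half Q.  Then f = phi^2 L with L the tangent at - Q.  Since phi enters through its
    square, it is invisible to first order, and f is ramified outside 0 and P only
    where a line of the slope of L is tangent to the curve, namely at Q
    ([unramified_generic], [unramified_opp_half]).  At Q, f - f(Q) is a square plus a
    term of order 3, so its order is even or 3 ([odd_ramification_half]), and the
    count of the fibre excludes the even case ([ramified_half]).  So P is a Lame point
    with third ramification point Q, a multiple of P that generates the same group;
    this is signature 1, and signature 0 would need a point of even order.

    Two general facts carry this argument.  The group law: an affine curve function
    A(x) + B(x) y is controlled by its norm to k(x), which gives orders of vanishing
    ([hord_prim], [hord_infty_regfun]) and the divisors of lines ([hdiv_line]); no
    function has a single simple pole, so points embed into divisor classes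
    ([principal_inj]), which yields associativity and also the functions with divisor
    m (P) - (m P) - (m - 1) (0).  And torsion: since k is algebraic over F_2, the
    multiples of a point lie in a finite field ([torsion]). *)

Set Implicit Arguments.
Unset Strict Implicit.
Unset Printing Implicit Defensive.

Import Order.TTheory GRing.Theory Num.Theory.
Local Open Scope ring_scope.

(** * A model of the function field *)
Lemma coef_lin0 (R : nzRingType) (a b : R) : (a%:P + b%:P * 'X)`_0 = a.
Proof. by rewrite coefD coefMX coefC /= addr0. Qed.

Lemma coef_lin1 (R : nzRingType) (a b : R) : (a%:P + b%:P * 'X)`_1 = b.
Proof. by rewrite coefD coefMX !coefC /= add0r. Qed.

(** All computations with functions take place in an abstract field having the
    three properties that characterise k(E): it contains k[x] and a root y of the
    Weierstrass equation, 1 and y are independent over k[x], and every element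
    is a fraction over k[x].  Working from these properties alone separates the
    arithmetic of functions from the quotient that defines [funfield]. *)
Record funmodel (k : fieldType) (W : weierstrass k) := FunModel {
  ff :> fieldType;
  fpol : {rmorphism {poly k} -> ff};
  yfun : ff;
  yfun_eq : yfun ^+ 2 + fpol (weq_lin W) * yfun = fpol (weq_cub W);
  fpol_free : forall A B, fpol A + fpol B * yfun = 0 -> A = 0 /\ B = 0;
  fpol_gen : forall f, exists A B d, d != 0 /\ f * fpol d = fpol A + fpol B * yfun }.
Arguments fpol {k W} _.
Arguments yfun {k W} _.

Section FunfieldBasis.
Variables (k : fieldType) (W : weierstrass k).
Local Notation irr := (weq_poly_irr W).
Local Notation lin := (weq_lin W).
Local Notation cub := (weq_cub W).

Definition funfield_type : fieldType := funfield W.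
Local Notation K := funfield_type.

Definition fpoly (A : {poly k}) : K := qfpoly_const irr (tofrac A).
Local Notation y := (fy W : K).

Lemma fpoly_is_zmod_morphism : zmod_morphism fpoly.
Proof. by move=> A B; rewrite /fpoly rmorphB; exact: (raddfB (qpolyC (weq_poly W))). Qed.
Lemma fpoly_is_monoid_morphism : monoid_morphism fpoly.
Proof.
split; first by rewrite /fpoly rmorph1.
by move=> A B; rewrite /fpoly tofracM; exact: (rmorphM (qpolyC (weq_poly W))).
Qed.
HB.instance Definition _ :=
  GRing.isZmodMorphism.Build {poly k} K fpoly fpoly_is_zmod_morphism.
HB.instance Definition _ :=
  GRing.isMonoidMorphism.Build {poly k} K fpoly fpoly_is_monoid_morphism.

(** The counterpart of [regfun] in the concrete function field. *)
Definition ffpair (A B : {poly k}) : K := fpoly A + fpoly B * y.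

Lemma mk_monic_weq : mk_monic (weq_poly W) = weq_poly W.
Proof. by apply: mk_monicE; exact: irr. Qed.

Lemma qpolyC_in c : qpolyC (weq_poly W) c = in_qpoly (weq_poly W) c%:P.
Proof.
apply: val_inj => /=.
rewrite Pdiv.Ring.rmodp_small // size_polyC mk_monic_weq size_weq_poly.
by case: eqP.
Qed.

Lemma ffpair_in A B :
  ffpair A B = in_qpoly (weq_poly W) ((tofrac A)%:P + (tofrac B)%:P * 'X).
Proof.
rewrite /ffpair /fpoly /fy /qfpoly_const !qpolyC_in.
by rewrite in_qpolyD in_qpolyM.
Qed.

Lemma fy_eq : y ^+ 2 + fpoly lin * y = fpoly cub.
Proof.
have w0 : in_qpoly (weq_poly W) (weq_poly W) = 0.
  apply: val_inj; rewrite /= mk_monic_weq; apply: Pdiv.RingMonic.rmodpp.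
  exact: weq_poly_monic.
have : in_qpoly (weq_poly W) ('X * 'X + (tofrac lin)%:P * 'X)
    = in_qpoly (weq_poly W) (tofrac cub)%:P.
  rewrite -[RHS]add0r -w0 -in_qpolyD; congr in_qpoly.
  by rewrite /weq_poly -expr2 subrK.
rewrite in_qpolyD 2!in_qpolyM => e.
by rewrite expr2 /fpoly /fy /qfpoly_const !qpolyC_in; exact: e.
Qed.

Lemma size_lin_weq (a b : {fraction {poly k}}) :
  (size (a%:P + b%:P * 'X)%R < size (weq_poly W))%N.
Proof.
rewrite size_weq_poly addrC size_MXaddC ltnS.
by case: ifP => // _; rewrite size_polyC; case: eqP.
Qed.

Lemma size_lin_mk (a b : {fraction {poly k}}) :
  (size (a%:P + b%:P * 'X)%R < size (mk_monic (weq_poly W)))%N.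
Proof. by rewrite mk_monic_weq size_lin_weq. Qed.

Lemma ffpair_eq0 A B : ffpair A B = 0 -> A = 0 /\ B = 0.
Proof.
rewrite ffpair_in => /(congr1 val) /=.
rewrite Pdiv.Ring.rmodp_small ?mk_monic_weq ?size_lin_weq // => e.
have [e0 e1] := (congr1 (fun p : {poly _} => p`_0) e, congr1 (fun p : {poly _} => p`_1) e).
rewrite coef_lin0 coef0 in e0; rewrite coef_lin1 coef0 in e1.
by split; apply/eqP; rewrite -tofrac_eq0; apply/eqP.
Qed.

Lemma ffpair_gen (f : K) : exists A B d, d != 0 /\ f * fpoly d = ffpair A B.
Proof.
have [[r1 r2] /= fE] : exists a : {fraction {poly k}} * {fraction {poly k}},
    f = qfpoly_const irr a.1 + qfpoly_const irr a.2 * y.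
  exists ((val f)`_0, (val f)`_1).
  rewrite /fy /qfpoly_const !qpolyC_in -[X in _ + X]in_qpolyM -[RHS]in_qpolyD.
  apply: val_inj; rewrite /= Pdiv.Ring.rmodp_small ?size_lin_mk //.
  apply/polyP=> -[|[|i]]; rewrite ?coef_lin0 ?coef_lin1 //.
  rewrite [RHS]nth_default; last first.
    have := size_lin_weq (val f)`_0 (val f)`_1; rewrite size_weq_poly => h.
    by rewrite -ltnS; apply: leq_trans h _.
  apply: nth_default; have h := size_mk_monic (f : {poly %/ weq_poly W}).
  have hm : (size (mk_monic (weq_poly W)) <= 3)%N by rewrite mk_monic_weq size_weq_poly.
  by rewrite -ltnS; apply: leq_trans (leq_trans h hm) _.
have [A [d [nd e1]]] := fraction_numden r1.
have [B [e [ne e2]]] := fraction_numden r2.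
exists (A * e), (B * d), (d * e); split; first by rewrite mulf_neq0.
have h1 : qfpoly_const irr r1 * fpoly d = fpoly A.
  rewrite /fpoly /qfpoly_const -(rmorphM (qpolyC (weq_poly W))) e1 divfK //.
  by rewrite tofrac_eq0.
have h2 : qfpoly_const irr r2 * fpoly e = fpoly B.
  rewrite /fpoly /qfpoly_const -(rmorphM (qpolyC (weq_poly W))) e2 divfK //.
  by rewrite tofrac_eq0.
rewrite fE /ffpair !rmorphM /= -h1 -h2.
rewrite mulrDl !mulrA; congr (_ + _); ring.
Qed.

Definition funfield_model : funmodel W :=
  @FunModel k W funfield_type fpoly y fy_eq ffpair_eq0 ffpair_gen.

End FunfieldBasis.

(** * Evaluating functions at points *)

Lemma poly2_ind (k : nzRingType) (P : {poly {poly k}} -> Prop) :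
  (forall c, P c%:P%:P) -> (forall p, P p -> P (p * 'X)) ->
  (forall p, P p -> P (p * 'X%:P)) ->
  (forall p q, P p -> P q -> P (p + q)) -> forall p, P p.
Proof.
move=> Pc PX PY PD; elim/poly_ind => [|p c IH].
  by have := Pc 0; rewrite !polyC0.
apply: (PD); first exact: PX.
elim/poly_ind: c => [|c d IHc]; first by have := Pc 0; rewrite !polyC0.
by rewrite polyCD polyCM; apply: (PD) => //; apply: PY.
Qed.

Section Sizes.
Variable k : idomainType.
Implicit Types A B : {poly k}.

Lemma size_mul_le A B m n :
  (size A <= m)%N -> (size B <= n.+1)%N -> (size (A * B)%R <= m + n)%N.
Proof. move=> h1 h2; have := size_polyMleq A B; lia. Qed.

Lemma size_add_le A B m :
  (size A <= m)%N -> (size B <= m)%N -> (size (A + B)%R <= m)%N.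
Proof.
by move=> h1 h2; rewrite (leq_trans (size_polyD _ _)) // geq_max h1.
Qed.

Lemma size_sub_le A B m :
  (size A <= m)%N -> (size B <= m)%N -> (size (A - B)%R <= m)%N.
Proof. by move=> h1 h2; apply: size_add_le; rewrite ?size_polyN. Qed.

Lemma size_leW A m n : (m <= n)%N -> (size A <= m)%N -> (size A <= n)%N.
Proof. by move=> h1 h2; apply: leq_trans h1. Qed.

(** The degree bounds leave a single term in the convolution. *)
Lemma coef_topM A B m n : (size A <= m.+1)%N -> (size B <= n.+1)%N ->
  (A * B)`_(m + n) = A`_m * B`_n.
Proof.
move=> sA sB; rewrite coefM.
have mi : (m < (m + n).+1)%N by rewrite ltnS leq_addr.
rewrite (bigD1 (Ordinal mi)) //= addKn big1 ?addr0 // => -[i hi] /=.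
rewrite -val_eqE /= => ne; case: (ltnP i m) => lt.
  by rewrite [X in _ * X]nth_default ?mulr0 //; apply: leq_trans sB _; lia.
rewrite [X in X * _]nth_default ?mul0r //; apply: leq_trans sA _.
move: ne => /eqP; lia.
Qed.
End Sizes.

Section Elements.
Variables (k : fieldType) (W : weierstrass k) (K : funmodel W).
Local Notation lin := (weq_lin W).
Local Notation cub := (weq_cub W).
Local Notation fpoly := (fpol K).
Local Notation yfun := (yfun K).

(** The ring k[x, y] of functions regular away from infinity. *)
Definition regfun A B : K := fpoly A + fpoly B * yfun.
Lemma regfun_eq0 A B : regfun A B = 0 -> A = 0 /\ B = 0.
Proof. exact: fpol_free. Qed.

Definition cstfun (c : k) : K := fpoly c%:P.
Lemma cstfun_is_zmod_morphism : zmod_morphism cstfun.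
Proof. by move=> a b; rewrite /cstfun polyCB rmorphB. Qed.
Lemma cstfun_is_monoid_morphism : monoid_morphism cstfun.
Proof. by split=> [|a b]; rewrite /cstfun (polyC1,polyCM) ?rmorph1 ?rmorphM. Qed.
HB.instance Definition _ :=
  GRing.isZmodMorphism.Build k K cstfun cstfun_is_zmod_morphism.
HB.instance Definition _ :=
  GRing.isMonoidMorphism.Build k K cstfun cstfun_is_monoid_morphism.

Definition xfun : K := fpoly 'X.

Lemma yfun_sqr : yfun ^+ 2 = fpoly cub - fpoly lin * yfun.
Proof. by rewrite -yfun_eq addrK. Qed.

Lemma regfunD A B C D : regfun A B + regfun C D = regfun (A + C) (B + D).
Proof. rewrite /regfun !rmorphD; ring. Qed.
Lemma regfunB A B C D : regfun A B - regfun C D = regfun (A - C) (B - D).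
Proof. rewrite /regfun !rmorphB; ring. Qed.
Lemma regfunX A B : xfun * regfun A B = regfun ('X * A) ('X * B).
Proof. rewrite /regfun /xfun !rmorphM; ring. Qed.
Lemma regfunPM C A B : fpoly C * regfun A B = regfun (C * A) (C * B).
Proof. rewrite /regfun !rmorphM; ring. Qed.
Lemma regfunM A B C D : regfun A B * regfun C D =
  regfun (A * C + B * D * cub) (A * D + B * C - B * D * lin).
Proof.
rewrite /regfun rmorphB !rmorphD !rmorphM.
transitivity (fpoly A * fpoly C + (fpoly A * fpoly D + fpoly B * fpoly C) * yfun
  + fpoly B * fpoly D * yfun ^+ 2); first by ring.
rewrite yfun_sqr; ring.
Qed.
Lemma yfun_regfun : yfun = regfun 0 1. Proof. by rewrite /regfun rmorph0 rmorph1 add0r mul1r. Qed.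
Lemma regfunY A B : yfun * regfun A B = regfun (B * cub) (A - B * lin).
Proof. rewrite yfun_regfun regfunM; congr (regfun _ _); ring. Qed.
Lemma fpoly_regfun A : fpoly A = regfun A 0.
Proof. by rewrite /regfun rmorph0 mul0r addr0. Qed.
Lemma regfun_neq0 A B : (regfun A B != 0) = (A != 0) || (B != 0).
Proof.
case: (eqVneq (regfun A B) 0) => [/regfun_eq0 [-> ->]|]; first by rewrite !eqxx.
case: (eqVneq A 0) => //= ->; case: (eqVneq B 0) => //= ->.
by rewrite -fpoly_regfun rmorph0 eqxx.
Qed.
Lemma fpoly_eq0 A : (fpoly A == 0) = (A == 0).
Proof. by apply: negb_inj; rewrite fpoly_regfun regfun_neq0 eqxx orbF. Qed.
Lemma yfun_neq0 : yfun != 0.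
Proof. by rewrite yfun_regfun regfun_neq0 oner_eq0 orbT. Qed.

Definition eval2 (X Y : K) (p : {poly {poly k}}) : K :=
  (map_poly (map_poly cstfun) p).[X, Y].

Lemma eval2D X Y p q : eval2 X Y (p + q) = eval2 X Y p + eval2 X Y q.
Proof. by rewrite /eval2 rmorphD /= !hornerD. Qed.
Lemma eval2M X Y p q : eval2 X Y (p * q) = eval2 X Y p * eval2 X Y q.
Proof. by rewrite /eval2 rmorphM /= !hornerM. Qed.
Lemma eval2X X Y : eval2 X Y 'X = X.
Proof. by rewrite /eval2 map_polyX hornerX hornerC. Qed.
Lemma eval2Y X Y : eval2 X Y 'X%:P = Y.
Proof. by rewrite /eval2 map_polyC /= map_polyX hornerC hornerX. Qed.
Lemma eval2C X Y c : eval2 X Y c%:P%:P = cstfun c.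
Proof. by rewrite /eval2 !map_polyC /= map_polyC /= !hornerC. Qed.

(** Affine coordinates near R: (x, y) at affine points, (x / y, 1 / y) at
    infinity; the abstract counterpart of [loc_fun]. *)
Definition chart (R : point W) : K * K :=
  if coords R is Some _ then (xfun, yfun) else (xfun / yfun, yfun^-1).
Definition evfun (R : point W) p : K := eval2 (chart R).1 (chart R).2 p.
Lemma evfunE R p : evfun R p = eval2 (chart R).1 (chart R).2 p.
Proof. by []. Qed.
Lemma evfunD R p q : evfun R (p + q) = evfun R p + evfun R q.
Proof. by rewrite !evfunE eval2D. Qed.
Lemma evfunM R p q : evfun R (p * q) = evfun R p * evfun R q.
Proof. by rewrite !evfunE eval2M. Qed.
Lemma evfunC R c : evfun R c%:P%:P = cstfun c.
Proof. by rewrite evfunE eval2C. Qed.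
Lemma evfunX R : evfun R 'X = (chart R).1.
Proof. by rewrite evfunE eval2X. Qed.
Lemma evfunY R : evfun R 'X%:P = (chart R).2.
Proof. by rewrite evfunE eval2Y. Qed.

Lemma chart_affine (R : point W) : R <> pt0 W -> chart R = (xfun, yfun).
Proof. by case: R => [[[a b]|] /= Rc] // []; apply: val_inj. Qed.
Lemma chart_infty : chart (pt0 W) = (xfun / yfun, yfun^-1).
Proof. by []. Qed.

Section Val.
Variable R : point W.
Lemma eval_valD p q : eval_val R (p + q) = eval_val R p + eval_val R q.
Proof. by rewrite /eval_val !hornerD. Qed.
Lemma eval_valM p q : eval_val R (p * q) = eval_val R p * eval_val R q.
Proof. by rewrite /eval_val !hornerM. Qed.
Lemma eval_valX : eval_val R 'X = (loc_val R).1.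
Proof. by rewrite /eval_val hornerX hornerC. Qed.
Lemma eval_valY : eval_val R 'X%:P = (loc_val R).2.
Proof. by rewrite /eval_val hornerC hornerX. Qed.
Lemma eval_valC c : eval_val R c%:P%:P = c.
Proof. by rewrite /eval_val !hornerC. Qed.
End Val.

Definition evreg (R : point W) (A B : {poly k}) : k :=
  A.[(loc_val R).1] + B.[(loc_val R).1] * (loc_val R).2.

Lemma loc_curve (R : point W) : R <> pt0 W ->
  (loc_val R).2 ^+ 2 = cub.[(loc_val R).1] - lin.[(loc_val R).1] * (loc_val R).2.
Proof.
case: R => [[[a b]|] /= Rc]; last by case; apply: val_inj.
move=> _; rewrite /loc_val /=; move/eqP: Rc => e.
apply/eqP; rewrite -subr_eq0; move/eqP: e; rewrite -subr_eq0 => /eqP e.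
by rewrite -e /weq_cub /weq_lin !hornerE; apply/eqP; ring.
Qed.

(** Reduction modulo the Weierstrass equation, which holds both for the functions
    x, y and for the coordinates of R. *)
Lemma affine_eval (R : point W) p : R <> pt0 W ->
  exists A B, evfun R p = regfun A B /\ eval_val R p = evreg R A B.
Proof.
move=> R0; have RE := chart_affine R0.
elim/poly2_ind: p => [c|p|p|p q].
- exists c%:P, 0; rewrite evfunC eval_valC -fpoly_regfun /evreg hornerC horner0.
  by rewrite mul0r addr0.
- move=> [A [B [e1 e2]]]; exists ('X * A), ('X * B).
  rewrite evfunM e1 evfunX RE eval_valM e2 eval_valX mulrC regfunX; split=> //.
  by rewrite /evreg !hornerM hornerX; ring.
- move=> [A [B [e1 e2]]]; exists (B * cub), (A - B * lin).
  rewrite evfunM e1 evfunY RE eval_valM e2 eval_valY mulrC regfunY; split=> //.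
  move: (weq_cub W) (weq_lin W) (loc_curve R0) => c l h.
  rewrite /evreg !(hornerD, hornerN, hornerM).
  by rewrite -[c.[_]](subrK (l.[(loc_val R).1] * (loc_val R).2)) -h; ring.
- move=> [A [B [e1 e2]]] [C [D [f1 f2]]]; exists (A + C), (B + D).
  rewrite evfunD e1 f1 regfunD eval_valD e2 f2; split=> //.
  by rewrite /evreg !hornerD; ring.
Qed.

(** A + B y has weight at most 6 M for the weights 2 of x and 3 of y, and c is its
    coefficient in weight 6 M; so c is the value at infinity of
    (A + B y) / y^(2 M).  Even powers of y suffice and make the leading monomial
    a power of x. *)
Definition bounded (A B : {poly k}) M (c : k) :=
  [/\ (size A <= (3 * M).+1)%N, (size B <= (3 * M).-1)%N & A`_(3 * M) = c].

Lemma size_lin : (size lin <= 2)%N.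
Proof.
rewrite (leq_trans (size_polyD _ _)) // geq_max size_polyC.
rewrite (leq_trans (size_scale_leq _ _)) ?size_polyX //.
by case: eqP.
Qed.
Lemma lead_cub : cub`_3 = 1.
Proof. by rewrite /weq_cub !coefD !coefZ !coefXn coefX coefC /= !mulr0 !addr0. Qed.
Lemma size_cub : (size cub <= 4)%N. Proof. by rewrite size_weq_cub. Qed.

(** y^2 = x^3 + lower weight, so multiplying by y^2 shifts the leading
    coefficient from x^(3 M) to x^(3 M + 3). *)
Lemma bounded_y2 A B M c : bounded A B M c ->
  exists A' B', yfun ^+ 2 * regfun A B = regfun A' B' /\ bounded A' B' M.+1 c.
Proof.
move=> [sA sB cA]; rewrite expr2 -mulrA !regfunY.
eexists; eexists; split; first reflexivity.
have [sc sl] := (size_cub, size_lin).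
have h1 : (size (A * cub)%R <= (3 * M).+1 + 3)%N by apply: size_mul_le.
have h2 : (size (B * lin * cub)%R <= (3 * M).-1 + 1 + 3)%N.
  by apply: size_mul_le => //; apply: size_mul_le.
have h3 : (size (B * cub)%R <= (3 * M).-1 + 3)%N by apply: size_mul_le.
have h4 : (size (A * lin)%R <= (3 * M).+1 + 1)%N by apply: size_mul_le.
have h5 : (size (B * lin * lin)%R <= (3 * M).-1 + 1 + 1)%N.
  by apply: size_mul_le => //; apply: size_mul_le.
case: M => [|M] in sA sB cA h1 h2 h3 h4 h5 *.
  have -> : B = 0 by apply/eqP; rewrite -size_poly_leq0.
  rewrite !mul0r !subr0 sub0r; split.
  - by move: h1; rewrite muln0.
  - by rewrite size_polyN; move: h4; rewrite muln0.
  - by rewrite -[(3 * 1)%N]/(0 + 3)%N coef_topM // cA lead_cub mulr1.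
split.
- rewrite mulrBl; apply: size_sub_le; first by apply: size_leW h1; lia.
  by apply: size_leW h2; lia.
- rewrite mulrBl opprB addrA; apply: size_sub_le; last by apply: size_leW h4; lia.
  apply: size_add_le; first by apply: size_leW h3; lia.
  by apply: size_leW h5; lia.
- rewrite mulrBl coefB [X in _ - X]nth_default; last by apply: leq_trans h2 _; lia.
  have -> : (3 * M.+2 = 3 * M.+1 + 3)%N by lia.
  by rewrite coef_topM // cA lead_cub mulr1 subr0.
Qed.

Lemma bounded_y A B M c : bounded A B M c ->
  exists A' B', yfun * regfun A B = regfun A' B' /\ bounded A' B' M.+1 0.
Proof.
move=> [sA sB cA]; rewrite !regfunY; eexists; eexists; split; first reflexivity.
have [sc sl] := (size_cub, size_lin).
have h3 : (size (B * cub)%R <= (3 * M).-1 + 3)%N by apply: size_mul_le.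
have h4 : (size (B * lin)%R <= (3 * M).-1 + 1)%N by apply: size_mul_le.
case: M => [|M] in sA sB cA h3 h4 *.
  have -> : B = 0 by apply/eqP; rewrite -size_poly_leq0.
  rewrite !mul0r !subr0; split; rewrite ?size_poly0 ?coef0 //.
  by apply: size_leW sA.
split; first by apply: size_leW h3; lia.
  by apply: size_sub_le; [apply: size_leW sA; lia| apply: size_leW h4; lia].
by rewrite nth_default //; apply: leq_trans h3 _; lia.
Qed.

Lemma bounded_xy A B M c : bounded A B M c ->
  exists A' B', xfun * yfun * regfun A B = regfun A' B' /\ bounded A' B' M.+1 0.
Proof.
move=> [sA sB cA]; rewrite -mulrA !regfunY regfunX; eexists; eexists; split; first reflexivity.
have [sc sl] := (size_cub, size_lin).
have sX : (size ('X : {poly k}) <= 2)%N by rewrite size_polyX.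
have h3 : (size (B * cub * 'X)%R <= (3 * M).-1 + 3 + 1)%N.
  by apply: size_mul_le => //; apply: size_mul_le.
have h4 : (size (B * lin * 'X)%R <= (3 * M).-1 + 1 + 1)%N.
  by apply: size_mul_le => //; apply: size_mul_le.
have h5 : (size (A * 'X)%R <= (3 * M).+1 + 1)%N by apply: size_mul_le.
rewrite -![('X : {poly k}) * _]mulrC mulrBl.
case: M => [|M] in sA sB cA h3 h4 h5 *.
  have -> : B = 0 by apply/eqP; rewrite -size_poly_leq0.
  by rewrite !mul0r !subr0; split; rewrite ?size_poly0 ?coef0.
split; first by apply: size_leW h3; lia.
  by apply: size_sub_le; [apply: size_leW h5; lia| apply: size_leW h4; lia].
by rewrite nth_default //; apply: leq_trans h3 _; lia.
Qed.

Lemma bounded_raise A B M c n : bounded A B M c ->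
  exists A' B', yfun ^+ (2 * n) * regfun A B = regfun A' B' /\ bounded A' B' (n + M) c.
Proof.
move=> h; elim: n => [|n [A' [B' [e b]]]]; first by exists A, B; rewrite mul1r.
have [A2 [B2 [e2 b2]]] := bounded_y2 b; exists A2, B2; split=> //.
by rewrite -e2 -e mulrA -exprD mulnS.
Qed.

Definition infty_val (f : K) (c : k) :=
  exists M A B, yfun ^+ (2 * M) * f = regfun A B /\ bounded A B M c.

Lemma infty_valD f g c d : infty_val f c -> infty_val g d -> infty_val (f + g) (c + d).
Proof.
move=> [M [A [B [e /(bounded_raise) b]]]] [N [C [D [h /(bounded_raise) b']]]].
have [A' [B' [eA [a1 a2 a3]]]] := b N; have [C' [D' [eC [c3 c4 c5]]]] := b' M.
exists (N + M)%N, (A' + C'), (B' + D'); rewrite -regfunD -eA -eC -e -h; split.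
  rewrite mulrDr !mulrA -!exprD; congr (yfun ^+ _ * _ + yfun ^+ _ * _); lia.
split; rewrite ?coefD.
- by apply: size_add_le; rewrite // addnC.
- by apply: size_add_le; rewrite // addnC.
- by rewrite a3 addnC c5.
Qed.

(** A polynomial in z = x / y and w = 1 / y, multiplied by a high power of y^2,
    lands in k[x, y]; the monomials with z or w then have strictly smaller
    weight, so that the leading coefficient is the constant term. *)
Lemma infinite_eval p : infty_val (evfun (pt0 W) p) (eval_val (pt0 W) p).
Proof.
have gyn := yfun_neq0.
elim/poly2_ind: p => [c|p|p|p q].
- rewrite evfunC eval_valC; exists 0%N, c%:P, 0.
  rewrite mul1r -fpoly_regfun; split=> //; split; rewrite ?size_poly0 ?coefC //.
  by rewrite size_polyC; case: eqP.
- move=> [M [A [B [e b]]]]; rewrite evfunM eval_valM eval_valX mulr0 evfunX chart_infty.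
  have [A' [B' [eA b']]] := bounded_xy b; exists M.+1, A', B'; split=> //.
  rewrite -eA -e mulnS exprD expr2.
  rewrite [_ * (xfun / yfun)]mulrC; move: (evfun _ p) (yfun ^+ _) => u v.
  rewrite -[RHS]mul1r -(mulfV gyn) /xfun; ring.
- move=> [M [A [B [e b]]]]; rewrite evfunM eval_valM eval_valY mulr0 evfunY chart_infty.
  have [A' [B' [eA b']]] := bounded_y b; exists M.+1, A', B'; split=> //.
  rewrite -eA -e mulnS exprD expr2.
  move: (evfun _ p) (yfun ^+ _) => u v.
  rewrite -[RHS]mul1r -(mulfV gyn) /xfun /=. ring.
- by rewrite evfunD eval_valD; exact: infty_valD.
Qed.

(** What makes the value of a function at a point well defined: a polynomial
    relation between the local coordinates holds at the point as well.  At
    infinity this is the weight comparison of [infinite_eval]. *)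
Lemma eval_fun0 R p : evfun R p = 0 -> eval_val R p = 0.
Proof.
case: (eqVneq R (pt0 W)) => [->|/eqP R0] e0; last first.
  have [A [B []]] := affine_eval p R0; rewrite e0 => /esym/regfun_eq0 [-> ->] ->.
  by rewrite /evreg !horner0 mul0r addr0.
have [M [A [B []]]] := infinite_eval p; rewrite e0 mulr0 => /esym/regfun_eq0 [-> _].
by case=> _ _ <-; rewrite coef0.
Qed.

End Elements.

(** * Local rings and uniformizers *)

Section LocalRing.
Variables (k : fieldType) (W : weierstrass k) (K : funmodel W).
Local Notation lin := (weq_lin W).
Local Notation cub := (weq_cub W).
Local Notation fpoly := (fpol K).
Local Notation gx := (xfun K).
Local Notation yfun := (yfun K).
Local Notation el := (regfun K).
Local Notation fcst := (cstfun K).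
Local Notation evfun := (evfun K).
Implicit Types (R : point W) (f g h t u : K) (c d : k).

(** [hasv], [unif] and [hord] are [has_value], [uniformizer] and [has_ord] in a
    model of the function field. *)
Definition hasv R f c := exists p q, [/\ eval_val R q != 0,
  f * evfun R q = evfun R p & c = eval_val R p / eval_val R q].

Definition unif R t := hasv R t 0 /\
  forall g, hasv R g 0 -> exists h c, hasv R h c /\ g = t * h.

Definition hord R f (m : int) := exists t u c,
  [/\ unif R t, hasv R u c, c != 0 & f = t ^ m * u].

Lemma evfun_neq0 R p : eval_val R p != 0 -> evfun R p != 0.
Proof. by apply: contra_neq; exact: eval_fun0. Qed.

Lemma hasv_uniq R f c d : hasv R f c -> hasv R f d -> c = d.
Proof.
move=> [p [q [nq fq ->]]] [p' [q' [nq' fq' ->]]].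
have : evfun R (p * q' + (- 1)%:P%:P * (p' * q)) = 0.
  by rewrite evfunD !evfunM evfunC -fq -fq' rmorphN1; ring.
move/eval_fun0; rewrite eval_valD !eval_valM eval_valC => e.
apply/eqP; rewrite eqr_div //; apply/eqP.
by apply/eqP; rewrite -subr_eq0; apply/eqP; rewrite -[RHS]e; ring.
Qed.

Lemma hasvC R c : hasv R (fcst c) c.
Proof.
by exists c%:P%:P, 1%:P%:P; rewrite !evfunC !eval_valC rmorph1 mulr1 oner_eq0 divr1.
Qed.
Lemma hasv0 R : hasv R 0 0. Proof. by have := hasvC R 0; rewrite rmorph0. Qed.
Lemma hasv1 R : hasv R 1 1. Proof. by have := hasvC R 1; rewrite rmorph1. Qed.

Lemma hasvD R f g c d : hasv R f c -> hasv R g d -> hasv R (f + g) (c + d).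
Proof.
move=> [p [q [nq fq ->]]] [p' [q' [nq' fq' ->]]].
exists (p * q' + p' * q), (q * q').
rewrite !eval_valD !eval_valM !evfunD !evfunM -fq -fq' mulf_neq0 // addf_div //.
by split=> //; ring.
Qed.

Lemma hasvM R f g c d : hasv R f c -> hasv R g d -> hasv R (f * g) (c * d).
Proof.
move=> [p [q [nq fq ->]]] [p' [q' [nq' fq' ->]]].
exists (p * p'), (q * q').
rewrite !eval_valM !evfunM -fq -fq' mulf_neq0 // mulf_div //.
by split=> //; ring.
Qed.

Lemma hasvN R f c : hasv R f c -> hasv R (- f) (- c).
Proof. by move/(hasvM (hasvC R (- 1))); rewrite rmorphN1 !mulN1r. Qed.

Lemma hasvB R f g c d : hasv R f c -> hasv R g d -> hasv R (f - g) (c - d).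
Proof. by move=> hf /hasvN; apply: hasvD. Qed.

Lemma hasvV R f c : c != 0 -> hasv R f c -> hasv R f^-1 c^-1.
Proof.
move=> nc [p [q [nq fq e]]].
have np : eval_val R p != 0 by apply: contraNneq nc => p0; rewrite e p0 mul0r.
exists q, p; rewrite e invf_div -fq; split=> //.
have nf : f != 0 by apply: contraTneq (evfun_neq0 np) => f0; rewrite -fq f0 mul0r eqxx.
by rewrite mulKf.
Qed.

Lemma hasvX R f c n : hasv R f c -> hasv R (f ^+ n) (c ^+ n).
Proof.
move=> h; elim: n => [|n IH]; first exact: hasv1.
by rewrite !exprS; apply: hasvM.
Qed.

Lemma hasv_val R f c d : c = d -> hasv R f c -> hasv R f d.
Proof. by move=> <-. Qed.

Lemma hasv_neq0 R f c : c != 0 -> hasv R f c -> f != 0.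
Proof.
move=> nc h; apply: contraNneq nc => f0; rewrite f0 in h.
by rewrite (hasv_uniq h (hasv0 R)).
Qed.

Lemma hasv_xfun R : R <> pt0 W -> hasv R gx (loc_val R).1.
Proof.
move=> R0; exists 'X, 1%:P%:P; rewrite evfunX evfunC eval_valC eval_valX (chart_affine _ R0).
by rewrite oner_eq0 rmorph1 mulr1 divr1.
Qed.
Lemma hasv_yfun R : R <> pt0 W -> hasv R yfun (loc_val R).2.
Proof.
move=> R0; exists 'X%:P, 1%:P%:P; rewrite evfunY evfunC eval_valC eval_valY (chart_affine _ R0).
by rewrite oner_eq0 rmorph1 mulr1 divr1.
Qed.
Lemma hasv_fpoly R A : R <> pt0 W -> hasv R (fpoly A) A.[(loc_val R).1].
Proof.
move=> R0; elim/poly_ind: A => [|A c IH]; first by rewrite rmorph0 horner0; exact: hasv0.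
rewrite rmorphD rmorphM hornerMXaddC; apply: hasvD; last exact: hasvC.
by apply: hasvM => //; exact: hasv_xfun.
Qed.
Lemma hasv_regfun R A B : R <> pt0 W -> hasv R (el A B) (evreg R A B).
Proof.
move=> R0; apply: hasvD; first exact: hasv_fpoly.
by apply: hasvM; [exact: hasv_fpoly | exact: hasv_yfun].
Qed.

(** With (a, b) the coordinates of R, the equation of the curve factors as
    (y - b) S = (x - a) G, where S and G take at R the values of the two partial
    derivatives, up to sign.  Where S does not vanish x - a is a uniformizer,
    where G does not vanish y - b is. *)
Definition locx R : K := gx - fcst (loc_val R).1.
Definition locy R : K := yfun - fcst (loc_val R).2.
Definition locS R : K := yfun + fcst (loc_val R).2 + fcst (a1 W) * gx + fcst (a3 W).
Definition locG R : K := let a := fcst (loc_val R).1 in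
  gx ^+ 2 + gx * a + a ^+ 2 + fcst (a2 W) * (gx + a) + fcst (a4 W)
  - fcst (a1 W) * fcst (loc_val R).2.
Definition dWy R : k := 2%:R * (loc_val R).2 + a1 W * (loc_val R).1 + a3 W.
Definition dWx R : k := 3%:R * (loc_val R).1 ^+ 2 + 2%:R * a2 W * (loc_val R).1
  + a4 W - a1 W * (loc_val R).2.

Lemma hasv_locx R : R <> pt0 W -> hasv R (locx R) 0.
Proof. move=> R0; rewrite -(subrr (loc_val R).1); apply: hasvB (hasv_xfun R0) (hasvC _ _). Qed.
Lemma hasv_locy R : R <> pt0 W -> hasv R (locy R) 0.
Proof. move=> R0; rewrite -(subrr (loc_val R).2); apply: hasvB (hasv_yfun R0) (hasvC _ _). Qed.

Lemma hasv_locS R : R <> pt0 W -> hasv R (locS R) (dWy R).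
Proof.
move=> R0; apply: (@hasv_val _ _ ((loc_val R).2 + (loc_val R).2 + a1 W * (loc_val R).1 + a3 W)).
- by rewrite /dWy; ring.
- apply: hasvD (hasvC _ _); apply: hasvD; first by apply: hasvD (hasv_yfun R0) (hasvC _ _).
  by apply: hasvM (hasvC _ _) (hasv_xfun R0).
Qed.
Lemma hasv_locG R : R <> pt0 W -> hasv R (locG R) (dWx R).
Proof.
move=> R0; pose a := (loc_val R).1; apply: (@hasv_val _ _ (a ^+ 2 + a * a + a ^+ 2 
   + a2 W * (a + a) + a4 W - a1 W * (loc_val R).2)).
- by rewrite /dWx -/a; ring.
- have hx := hasv_xfun R0; have hC := hasvC R.
  apply: hasvB; last by apply: hasvM.
  apply: hasvD (hC _); apply: hasvD; last by apply: hasvM (hC _) _; apply: hasvD.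
  apply: hasvD; last by apply: hasvX.
  by apply: hasvD; [apply: hasvX| apply: hasvM].
Qed.

Lemma weq_fun : yfun ^+ 2 + fcst (a1 W) * gx * yfun + fcst (a3 W) * yfun
  = gx ^+ 3 + fcst (a2 W) * gx ^+ 2 + fcst (a4 W) * gx + fcst (a6 W).
Proof.
have := yfun_eq K; rewrite /weq_lin /weq_cub !rmorphD -!mul_polyC.
by rewrite !(rmorphXn, rmorphM) /fcst /gx => <-; ring.
Qed.

Lemma weq_loc R : R <> pt0 W -> let a := (loc_val R).1 in let b := (loc_val R).2 in
  b ^+ 2 + a1 W * a * b + a3 W * b = a ^+ 3 + a2 W * a ^+ 2 + a4 W * a + a6 W.
Proof. by case: R => [[[a b]|] /= Rc] // => [_|[]]; [apply/eqP | apply: val_inj]. Qed.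

Lemma locy_locS R : R <> pt0 W -> locy R * locS R = locx R * locG R.
Proof.
move=> R0; have := congr1 fcst (weq_loc R0); rewrite !(rmorphD, rmorphM, rmorphXn) /=.
have := weq_fun; rewrite /locy /locS /locx /locG.
move: (fcst (loc_val R).1) (fcst (loc_val R).2) (fcst (a1 W)) (fcst (a2 W)) => a b A1 A2.
move: (fcst (a3 W)) (fcst (a4 W)) (fcst (a6 W)) gx yfun => A3 A4 A6 X Y e1 e2.
apply/eqP; rewrite -subr_eq0; apply/eqP.
have -> : 0 = (Y ^+ 2 + A1 * X * Y + A3 * Y - (X ^+ 3 + A2 * X ^+ 2 + A4 * X + A6)) 
  - (b ^+ 2 + A1 * a * b + A3 * b - (a ^+ 3 + A2 * a ^+ 2 + A4 * a + A6)) :> K.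
  by rewrite e1 e2 !subrr.
ring.
Qed.

Lemma regfun_split R A B : R <> pt0 W -> evreg R A B = 0 ->
  exists C, el A B = locx R * fpoly C + locy R * fpoly B.
Proof.
move=> R0 e.
have /factor_theorem [C eC] : root (A + B * (loc_val R).2%:P) (loc_val R).1.
  by rewrite rootE !hornerE /=; apply/eqP.
exists C; rewrite /locx /locy.
have -> : gx - fcst (loc_val R).1 = fpoly ('X - (loc_val R).1%:P) by rewrite rmorphB.
rewrite [_ * fpoly C]mulrC -rmorphM -eC rmorphD rmorphM /el /fcst; ring.
Qed.

(** The maximal ideal of an affine point is generated by x - a and y - b. *)
Lemma value0_split R g : R <> pt0 W -> hasv R g 0 ->
  exists h1 c1 h2 c2, [/\ hasv R h1 c1, hasv R h2 c2 & g = locx R * h1 + locy R * h2].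
Proof.
move=> R0 [p [q [nq e]]] /esym/eqP; rewrite mulf_eq0 invr_eq0 (negPf nq) orbF => /eqP p0.
have [A [B [eA vA]]] := affine_eval K p R0.
have [A' [B' [eA' vA']]] := affine_eval K q R0.
have [C eC] : exists C, el A B = locx R * fpoly C + locy R * fpoly B.
  by apply: regfun_split; rewrite -?vA.
have hq : hasv R (evfun R q)^-1 (eval_val R q)^-1.
  by apply: hasvV => //; rewrite eA' vA'; apply: hasv_regfun.
exists (fpoly C / evfun R q), (C.[(loc_val R).1] / eval_val R q),
  (fpoly B / evfun R q), (B.[(loc_val R).1] / eval_val R q); split.
- by apply: hasvM => //; apply: hasv_fpoly.
- by apply: hasvM => //; apply: hasv_fpoly.
- apply: (mulIf (evfun_neq0 nq)); rewrite e eA eC.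
  by rewrite [RHS]mulrDl -![_ * _ * evfun R q]mulrA mulVf ?mulr1 ?evfun_neq0.
Qed.

Lemma unif_locx R : R <> pt0 W -> dWy R != 0 -> unif R (locx R).
Proof.
move=> R0 nS; split=> [|g]; first exact: hasv_locx.
move/(value0_split R0) => [h1 [c1 [h2 [c2 [H1 H2 ->]]]]].
have hS := hasv_locS R0; have nS' := hasv_neq0 nS hS.
exists (h1 + locG R / locS R * h2), (c1 + dWx R / dWy R * c2); split.
  apply: hasvD => //; apply: hasvM => //; apply: hasvM (hasv_locG R0) _.
  exact: hasvV.
rewrite mulrDr !mulrA -locy_locS //; congr (_ + _ * _); by rewrite mulfK.
Qed.

Lemma unif_locy R : R <> pt0 W -> dWx R != 0 -> unif R (locy R).
Proof.
move=> R0 nG; split=> [|g]; first exact: hasv_locy.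
move/(value0_split R0) => [h1 [c1 [h2 [c2 [H1 H2 ->]]]]].
have hG := hasv_locG R0; have nG' := hasv_neq0 nG hG.
exists (locS R / locG R * h1 + h2), (dWy R / dWx R * c1 + c2); split.
  apply: hasvD => //; apply: hasvM => //; apply: hasvM (hasv_locS R0) _.
  exact: hasvV.
rewrite mulrDr !mulrA locy_locS //; congr (_ * _ + _); by rewrite mulfK.
Qed.

(** At infinity z = x / y and w = 1 / y satisfy w U = z^3 with U of value 1; hence
    w has order 3 as soon as z is a uniformizer. *)
Definition locz : K := gx / yfun.
Definition locw : K := yfun^-1.
Definition locU : K := 1 + fcst (a1 W) * locz + fcst (a3 W) * locw
  - fcst (a2 W) * locz ^+ 2 - fcst (a4 W) * locz * locw - fcst (a6 W) * locw ^+ 2.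

Lemma hasv_locz : hasv (pt0 W) locz 0.
Proof.
exists 'X, 1%:P%:P; rewrite evfunX evfunC eval_valC eval_valX.
by rewrite oner_eq0 rmorph1 mulr1 divr1.
Qed.
Lemma hasv_locw : hasv (pt0 W) locw 0.
Proof.
exists 'X%:P, 1%:P%:P; rewrite evfunY evfunC eval_valC eval_valY.
by rewrite oner_eq0 rmorph1 mulr1 divr1.
Qed.
Lemma hasv_locU : hasv (pt0 W) locU 1.
Proof.
have [[hz hw] hC] := (hasv_locz, hasv_locw, hasvC (pt0 W)).
apply: (@hasv_val _ _ (1 + a1 W * 0 + a3 W * 0 - a2 W * 0 ^+ 2 - a4 W * 0 * 0 - a6 W * 0 ^+ 2)).
- ring.
- apply: hasvB; last by apply: hasvM => //; apply: hasvX.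
  apply: hasvB; last by apply: hasvM => //; apply: hasvM.
  apply: hasvB; last by apply: hasvM => //; apply: hasvX.
  apply: hasvD; last by apply: hasvM.
  by apply: hasvD; [exact: hasv1 | apply: hasvM].
Qed.
Lemma locwU : locw * locU = locz ^+ 3.
Proof.
have ny := yfun_neq0 K; have e := weq_fun.
rewrite /locU /locw /locz; apply: (mulfI (expf_neq0 3 ny)).
rewrite [in RHS]expr_div_n [RHS]mulrC divfK ?expf_neq0 //.
apply/eqP; rewrite -subr_eq0; move/eqP: e; rewrite -subr_eq0 => /eqP e.
apply/eqP; rewrite -[RHS]e; move: ny; move: (fcst _) (fcst _) (fcst _) (fcst _) (fcst _) gx yfun.
by move=> A1 A2 A3 A4 A6 X Y ny; field.
Qed.

End LocalRing.

Section Smooth.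
Variables (k : fieldType) (W : weierstrass k).

(** Moving a singular point to the origin kills a3, a4 and a6, hence the
    discriminant; this is the invariance that allows the move. *)
Lemma discriminant_translate (r s : k) :
  let W' := Weierstrass (a1 W) (a2 W + 3%:R * r) (a3 W + r * a1 W + 2%:R * s)
    (a4 W + 2%:R * r * a2 W - s * a1 W + 3%:R * r ^+ 2)
    (a6 W + r * a4 W + r ^+ 2 * a2 W + r ^+ 3 - s * a3 W - s ^+ 2 - r * s * a1 W) in
  discriminant W' = discriminant W.
Proof. rewrite /= /discriminant /b2 /b4 /b6 /b8 /=; ring. Qed.

Lemma smooth_partials (R : point W) : discriminant W != 0 -> R <> pt0 W ->
  dWy R = 0 -> dWx R != 0.
Proof.
move=> nd R0 ey; apply: contra_neqN nd => /eqP ex.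
have ew := weq_loc R0; move: ew ey ex; rewrite /dWy /dWx /=.
set a := (loc_val R).1; set b := (loc_val R).2 => ew ey ex.
rewrite -(discriminant_translate a b) /discriminant /b2 /b4 /b6 /b8 /=.
have -> : a3 W + a * a1 W + 2%:R * b = 0 by rewrite -ey; ring.
have -> : a4 W + 2%:R * a * a2 W - b * a1 W + 3%:R * a ^+ 2 = 0 by rewrite -ex; ring.
have -> : a6 W + a * a4 W + a ^+ 2 * a2 W + a ^+ 3 - b * a3 W - b ^+ 2 - a * b * a1 W = 0.
  move/eqP: ew; rewrite -subr_eq0 => /eqP ew.
  by rewrite -[RHS]oppr0 -ew; ring.
ring.
Qed.
End Smooth.

(** * Orders of vanishing *)

Section Orders.
Variables (k : fieldType) (E : ellcurve k) (K : funmodel E).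
Local Notation W := (weq E).
Let smooth : discriminant W != 0 := weq_smooth E.
Local Notation lin := (weq_lin W).
Local Notation cub := (weq_cub W).
Local Notation fpoly := (fpol K).
Local Notation gx := (xfun K).
Local Notation yfun := (yfun K).
Local Notation el := (regfun K).
Local Notation fcst := (cstfun K).
Local Notation evfun := (evfun K).
Local Notation locz := (locz K).
Local Notation locw := (locw K).
Local Notation locU := (locU K).
Implicit Types (R : point W) (f g h t u v : K) (c d : k) (m n : int).

(** At infinity the maximal ideal is generated by z and w, and w is a multiple
    of z. *)
Lemma poly2_split0 (p : {poly {poly k}}) : exists p1 p2,
  p = p1 * 'X + p2 * 'X%:P + (eval_val (pt0 W) p)%:P%:P.
Proof.
elim/poly2_ind: p => [c|p _|p _|p q [p1 [p2 e]] [q1 [q2 e']]].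
- by exists 0, 0; rewrite eval_valC !mul0r !add0r.
- exists p, 0; rewrite eval_valM eval_valX mulr0 mul0r !addr0 //.
- exists 0, p; rewrite eval_valM eval_valY mulr0 mul0r add0r addr0 //.
- exists (p1 + q1), (p2 + q2).
  by rewrite {1}e {1}e' eval_valD !polyCD; ring.
Qed.

Lemma unif_locz : unif (pt0 W) locz.
Proof.
split=> [|g [p [q [nq e]]]]; first exact: hasv_locz.
move/esym/eqP; rewrite mulf_eq0 invr_eq0 (negPf nq) orbF => /eqP p0.
have [p1 [p2]] := poly2_split0 p; rewrite p0 !polyC0 addr0 => pE.
have hU := hasv_locU K; have nU := hasv_neq0 (oner_neq0 _) hU.
have hef r : hasv (pt0 W) (evfun (pt0 W) r) (eval_val (pt0 W) r).
  by exists r, 1%:P%:P; rewrite evfunC eval_valC rmorph1 mulr1 divr1 oner_eq0.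
have hq := hasvV nq (hef q).
exists ((evfun (pt0 W) p1 + locz ^+ 2 / locU * evfun (pt0 W) p2) / evfun (pt0 W) q).
eexists; split.
  apply: hasvM hq; apply: hasvD (hef _) _; apply: hasvM (hef _).
  by apply: hasvM (hasvV (oner_neq0 _) hU); apply: hasvX; exact: hasv_locz.
apply: (mulIf (@evfun_neq0 _ _ K _ _ nq)); rewrite e {1}pE evfunD !evfunM evfunX evfunY /=.
rewrite -[RHS]mulrA divfK ?evfun_neq0 // -/locz -/locw.
have -> : locw = locz ^+ 3 / locU by rewrite -locwU mulfK.
by rewrite -/(gx / yfun); ring.
Qed.

Lemma unif_exists R : exists t, unif R t.
Proof.
case: (eqVneq R (pt0 W)) => [->|/eqP R0]; first by exists locz; exact: unif_locz.
case: (eqVneq (dWy R) 0) => ey; last by exists (locx K R); apply: unif_locx.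
by exists (locy K R); apply: unif_locy => //; apply: smooth_partials.
Qed.

Lemma xfun_neq0 : gx != 0. Proof. by rewrite fpoly_eq0 polyX_eq0. Qed.
Lemma locxE R : locx K R = fpoly ('X - (loc_val R).1%:P).
Proof. by rewrite rmorphB. Qed.
Lemma locx_neq0 R : locx K R != 0.
Proof. by rewrite locxE fpoly_eq0 polyXsubC_eq0. Qed.

Lemma unif_neq0 R t : unif R t -> t != 0.
Proof.
move=> [_ ut]; suff [g ng hg] : exists2 g : K, g != 0 & hasv R g 0.
  have [h [c [_ gE]]] := ut g hg.
  by apply: contraNneq ng => t0; rewrite gE t0 mul0r.
case: (eqVneq R (pt0 W)) => [->|/eqP R0].
  exists locz; last exact: hasv_locz.
  by rewrite mulf_neq0 ?invr_neq0 ?xfun_neq0 ?yfun_neq0.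
by exists (locx K R); [exact: locx_neq0 | exact: hasv_locx].
Qed.

Lemma unif_unit R t t' : unif R t -> unif R t' ->
  exists v c, [/\ hasv R v c, c != 0 & t' = t * v].
Proof.
move=> ut ut'; have nt := unif_neq0 ut'.
have [h [c [hc e]]] := ut.2 _ ut'.1; have [h' [c' [hc' e']]] := ut'.2 _ ut.1.
exists h, c; split=> //; apply: contraTneq (oner_neq0 k) => c0.
rewrite negbK; apply/eqP; apply: (hasv_uniq (hasv1 K R)).
have -> : 1 = h * h' by apply: (mulfI nt); rewrite mulr1 {1}e {1}e'; ring.
by rewrite -[0](mul0r c') -c0; apply: hasvM.
Qed.

Lemma hasv_unitXz R u c (m : int) : c != 0 -> hasv R u c -> hasv R (u ^ m) (c ^ m).
Proof.
move=> nc hu; case: m => m; first by rewrite -!exprnP; apply: hasvX.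
by rewrite !NegzE -!exprnN; apply: hasvV; [rewrite expf_neq0 | apply: hasvX].
Qed.

(** The order can be computed with any uniformizer, two of them differing by a
    unit. *)
Lemma hord_with R t f m : unif R t -> hord R f m ->
  exists u c, [/\ hasv R u c, c != 0 & f = t ^ m * u].
Proof.
move=> ut [t' [u [c [ut' hu nc ->]]]].
have [v [d [hv nd ->]]] := unif_unit ut ut'.
exists (v ^ m * u), (d ^ m * c); split; last by rewrite expfzMl mulrA.
  by apply: hasvM => //; apply: hasv_unitXz.
by rewrite mulf_neq0 // expfz_neq0.
Qed.

Lemma hordI R t f m u c : unif R t -> hasv R u c -> c != 0 -> f = t ^ m * u -> hord R f m.
Proof. by move=> ut hu nc ->; exists t, u, c. Qed.

Lemma hord_neq0 R f m : hord R f m -> f != 0.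
Proof.
move=> [t [u [c [/unif_neq0 nt hu nc ->]]]].
by rewrite mulf_neq0 ?expfz_neq0 // (hasv_neq0 nc hu).
Qed.

Lemma hordM R f g m n : hord R f m -> hord R g n -> hord R (f * g) (m + n).
Proof.
have [t ut] := unif_exists R.
move=> /(hord_with ut) [u [c [hu nc ->]]] /(hord_with ut) [v [d [hv nd ->]]].
apply: (hordI ut (hasvM hu hv)); first by rewrite mulf_neq0.
by rewrite expfzDr ?(unif_neq0 ut) //; ring.
Qed.

Lemma hordV R f m : hord R f m -> hord R f^-1 (- m).
Proof.
have [t ut] := unif_exists R.
move=> /(hord_with ut) [u [c [hu nc ->]]].
apply: (hordI ut (hasvV nc hu)); first by rewrite invr_eq0.
by rewrite invfM -invr_expz.
Qed.

Lemma hord_unit R f c : c != 0 -> hasv R f c -> hord R f 0.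
Proof.
have [t ut] := unif_exists R; move=> nc hf.
by apply: (hordI ut hf nc); rewrite expr0z mul1r.
Qed.

Lemma hord0_value R f : hord R f 0 -> exists2 c, c != 0 & hasv R f c.
Proof.
have [t ut] := unif_exists R => /(hord_with ut) [u [c [hu nc ->]]].
by exists c; rewrite // expr0z mul1r.
Qed.

Lemma hord1 R : hord R (1 : K) 0.
Proof. exact: hord_unit (oner_neq0 _) (hasv1 _ _). Qed.

Lemma hordX R f m (n : nat) : hord R f m -> hord R (f ^+ n) (m *+ n).
Proof.
move=> h; elim: n => [|n IH]; first exact: hord1.
by rewrite exprS mulrS; apply: hordM.
Qed.

Lemma hord_pos R f m : 0 < m -> hord R f m -> hasv R f 0.
Proof.
have [t ut] := unif_exists R => m0 /(hord_with ut) [u [c [hu nc ->]]].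
case: m m0 => // -[|m] // _; rewrite -exprnP exprS -mulrA.
rewrite -[0](mul0r (0 ^+ m * c)); apply: hasvM; first exact: ut.1.
by apply: hasvM => //; apply: hasvX; exact: ut.1.
Qed.

Lemma hord_ge0 R f m : 0 <= m -> hord R f m -> exists c, hasv R f c.
Proof.
rewrite le_eqVlt => /predU1P [<- /hord0_value [c _]|]; first by exists c.
by move=> m0 /hord_pos; exists 0; auto.
Qed.

Lemma hord_uniq R f m n : hord R f m -> hord R f n -> m = n.
Proof.
wlog lt : m n / m < n => [wl|] hm hn.
  by case: (ltgtP m n) => // lt; [exact: wl | apply/esym/wl].
have := hordM hm (hordV hm); rewrite subrr.
have := hordM hn (hordV hm) => h2 /hord0_value [c nc h1].
have := hord_pos _ h2; rewrite subr_gt0 => /(_ lt) h3.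
by move: nc; rewrite (hasv_uniq h1 h3) eqxx.
Qed.

(** g / f has value 0, hence 1 + g / f is a unit. *)
Lemma hordD R f g m n : hord R f m -> hord R g n -> m < n -> hord R (f + g) m.
Proof.
move=> hf hg lt.
have nf := hord_neq0 hf.
have -> : f + g = f * (1 + g / f) by rewrite mulrDr mulr1 mulrC divfK.
rewrite -[m]addr0; apply: hordM => //.
apply: (@hord_unit _ _ (1 + 0)); first by rewrite addr0 oner_eq0.
apply: hasvD; first exact: hasv1.
by apply: (hord_pos _ (hordM hg (hordV hf))); rewrite subr_gt0.
Qed.

Lemma hordN R f m : hord R f m -> hord R (- f) m.
Proof.
move=> h; rewrite -mulN1r -[m]add0r; apply: hordM => //.
have n1 : (- 1 : k) != 0 by rewrite oppr_eq0 oner_eq0.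
by have := hord_unit n1 (hasvC K R (- 1)); rewrite rmorphN1.
Qed.

Lemma hord_cst R c : c != 0 -> hord R (fcst c) 0.
Proof. by move=> nc; apply: hord_unit nc (hasvC _ _ _). Qed.

Lemma hord_mulu R f g m c : c != 0 -> hasv R g c -> hord R f m -> hord R (f * g) m.
Proof. by move=> nc hg hf; rewrite -[m]addr0; apply: hordM (hord_unit nc hg). Qed.

Lemma hord_divu R f g m c : c != 0 -> hasv R g c -> hord R f m -> hord R (f / g) m.
Proof. by move=> nc hg; apply: hord_mulu (hasvV nc hg); rewrite invr_eq0. Qed.

End Orders.

(** * Opposite points and norms *)

Section Conj.
Variables (k : fieldType) (W : weierstrass k).
Local Notation lin := (weq_lin W).
Local Notation cub := (weq_cub W).

Definition opp_coords (p : option (k * k)) : option (k * k) :=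
  if p is Some (x, y) then Some (x, - y - a1 W * x - a3 W) else None.

Lemma opp_on_curve (P : point W) : on_curve W (opp_coords (coords P)).
Proof.
case: P => [[[x y]|] //= /eqP e]; rewrite -e; apply/eqP; ring.
Qed.
Definition opp_pt P : point W := Point (opp_on_curve P).

Lemma opp_ptK : involutive opp_pt.
Proof. by case=> [[[x y]|] h]; apply: val_inj => //=; congr (Some (_, _)); ring. Qed.
Lemma opp_pt0 : opp_pt (pt0 W) = pt0 W. Proof. exact: val_inj. Qed.
Lemma opp_pt_eq0 R : (opp_pt R = pt0 W) <-> (R = pt0 W).
Proof.
by split=> [e|->]; [rewrite -(opp_ptK R) e opp_pt0 | rewrite opp_pt0].
Qed.

Lemma loc_val_opp R : R <> pt0 W -> loc_val (opp_pt R) =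
  ((loc_val R).1, - (loc_val R).2 - a1 W * (loc_val R).1 - a3 W).
Proof. by case: R => [[[a b]|] /= Rc] // []; apply: val_inj. Qed.

Lemma loc_val_inj R T : R <> pt0 W -> T <> pt0 W -> loc_val R = loc_val T -> R = T.
Proof.
case: R => [[[a b]|] hR] R0; last by case: R0; apply: val_inj.
case: T => [[[c d]|] hT] T0; last by case: T0; apply: val_inj.
by rewrite /loc_val /= => e; apply: val_inj; rewrite /= e.
Qed.

Lemma lin_horner x : lin.[x] = a1 W * x + a3 W.
Proof. by rewrite /weq_lin !hornerE. Qed.
Lemma same_x_opp R T : R <> pt0 W -> T <> pt0 W -> (loc_val R).1 = (loc_val T).1 ->
  T = R \/ T = opp_pt R.
Proof.
move=> R0 T0 ex; have oR0 : opp_pt R <> pt0 W by rewrite opp_pt_eq0.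
have : ((loc_val T).2 - (loc_val R).2) * ((loc_val T).2 - (loc_val (opp_pt R)).2) = 0.
  rewrite loc_val_opp //=; have := loc_curve R0; have := loc_curve T0; rewrite -ex lin_horner.
  move: (cub.[(loc_val R).1]) => c /eqP; rewrite -subr_eq0 => /eqP e1.
  move=> /eqP; rewrite -subr_eq0 => /eqP e2.
  have e : 0 - 0 = 0 :> k by rewrite subrr.
  by rewrite -[RHS]e -{1}e1 -e2; ring.
move/eqP; rewrite mulf_eq0 !subr_eq0 => /orP [] /eqP ey; [left|right];
  apply: loc_val_inj => //; rewrite [LHS]surjective_pairing [RHS]surjective_pairing ey //.
  by rewrite ex.
by rewrite -ex loc_val_opp.
Qed.

(** The norm of A + B y from k(E) to k(x). *)
Definition xnorm (A B : {poly k}) : {poly k} := A ^+ 2 - A * B * lin - B ^+ 2 * cub.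

Lemma evreg_opp R A B : R <> pt0 W -> evreg (opp_pt R) A B = evreg R (A - B * lin) (- B).
Proof.
move=> R0; rewrite /evreg loc_val_opp //= hornerD !hornerN hornerM lin_horner.
ring.
Qed.

(** The norm is the product with the conjugate, and conjugation of functions is
    composition with R -> - R. *)
Lemma xnorm_horner R A B : R <> pt0 W ->
  (xnorm A B).[(loc_val R).1] = evreg R A B * evreg (opp_pt R) A B.
Proof.
move=> R0; rewrite /evreg loc_val_opp //=; have := loc_curve R0.
have := lin_horner (loc_val R).1; rewrite /xnorm; move: cub lin => C L eL.
rewrite !(hornerD, hornerN, hornerM, horner_exp) eL.
move: (C.[_]) => c /eqP; rewrite -subr_eq0 => /eqP e.
apply/eqP; rewrite -subr_eq0; apply/eqP.
by rewrite -[RHS](mulr0 (B.[(loc_val R).1] ^+ 2)) -e; ring.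
Qed.
End Conj.

Section AffineOrders.
Variables (k : fieldType) (E : ellcurve k) (K : funmodel E).
Local Notation W := (weq E).
Let smooth : discriminant W != 0 := weq_smooth E.
Local Notation lin := (weq_lin W).
Local Notation cub := (weq_cub W).
Local Notation fpoly := (fpol K).
Local Notation gx := (xfun K).
Local Notation yfun := (yfun K).
Local Notation el := (regfun K).
Local Notation fcst := (cstfun K).
Local Notation locz := (locz K).
Local Notation locw := (locw K).
Local Notation locU := (locU K).
Implicit Types (R : point W) (A B : {poly k}).

Lemma regfun_xnorm A B : el A B * el (A - B * lin) (- B) = fpoly (xnorm W A B).
Proof. by rewrite regfunM fpoly_regfun; congr (el _ _); rewrite /xnorm; ring. Qed.

Lemma xnorm_neq0 A B : el A B != 0 -> xnorm W A B != 0.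
Proof.
move=> n; rewrite -(fpoly_eq0 K) -regfun_xnorm mulf_neq0 // regfun_neq0 oppr_eq0.
move: n; rewrite regfun_neq0; case: (eqVneq B 0) => [->|_] /=; last by rewrite !orbT.
by rewrite mul0r subr0.
Qed.

Lemma hord_locx1 R : R <> pt0 W -> dWy R != 0 -> hord R (locx K R) 1.
Proof.
move=> R0 n; apply: (hordI (unif_locx K R0 n) (hasv1 _ _) (oner_neq0 _)).
by rewrite expr1z mulr1.
Qed.

Lemma hord_locy1 R : R <> pt0 W -> dWy R = 0 -> hord R (locy K R) 1.
Proof.
move=> R0 n; have nx := smooth_partials smooth R0 n.
apply: (hordI (unif_locy K R0 nx) (hasv1 _ _) (oner_neq0 _)).
by rewrite expr1z mulr1.
Qed.

(** At a point of order 2 the tangent is vertical: there S = (y - b) + a1 (x - a),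
    so that (x - a) G = (y - b) S makes x - a the square of y - b up to a unit. *)
Lemma hord_locx2 R : R <> pt0 W -> dWy R = 0 -> hord R (locx K R) 2.
Proof.
move=> R0 n; have nx := smooth_partials smooth R0 n.
have hG := hasv_locG K R0; have nG := hasv_neq0 nx hG.
(* S has no constant term, its value at R being the vanishing derivative *)
have eS : locS K R = locy K R + fcst (a1 W) * locx K R.
  rewrite /locS /locx /locy -[RHS]addr0 -(rmorph0 fcst) -n /dWy.
  by rewrite !(rmorphD, rmorphM); ring.
have hS : hord R (locS K R) 1.
  have h1 := hord_locy1 R0 n.
  have -> : locS K R = locy K R / (1 - fcst (a1 W) * locy K R / locG K R).
    have hv : hasv R (1 - fcst (a1 W) * locy K R / locG K R) (1 - a1 W * 0 / dWx R).
      apply: hasvB (hasv1 _ _) _; apply: hasvM (hasvV nx hG).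
      by apply: hasvM (hasvC _ _ _) (hasv_locy _ R0).
    have nv : 1 - fcst (a1 W) * locy K R / locG K R != 0.
      by apply: hasv_neq0 hv; rewrite mulr0 mul0r subr0 oner_eq0.
    apply: (mulIf nv); rewrite divfK // mulrBr mulr1 {1}eS.
    have -> : locx K R = locy K R * locS K R / locG K R by rewrite locy_locS // mulfK.
    by ring.
  have nv : 1 - a1 W * 0 / dWx R != 0 by rewrite mulr0 mul0r subr0 oner_eq0.
  apply: (hord_divu nv _ h1).
  apply: hasvB (hasv1 _ _) _; apply: hasvM (hasvV nx hG).
  by apply: hasvM (hasvC _ _ _) (hasv_locy _ R0).
have -> : locx K R = locy K R * locS K R / locG K R by rewrite locy_locS // mulfK.
apply: (hord_divu nx hG).
exact: (hordM (hord_locy1 R0 n) hS).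
Qed.

Lemma hord_locx R : R <> pt0 W ->
  hord R (locx K R) (if dWy R == 0 then 2 else 1).
Proof. by move=> R0; case: eqP => [/(hord_locx2 R0)|/eqP /(hord_locx1 R0)]. Qed.

Lemma dWy_opp R : R <> pt0 W -> (dWy R == 0) = (opp_pt R == R).
Proof.
move=> R0; apply/eqP/eqP => [e|/(congr1 (@loc_val _ _))].
  apply: loc_val_inj => //; first by rewrite opp_pt_eq0.
  rewrite loc_val_opp // [RHS]surjective_pairing; congr (_, _).
  by apply/eqP; rewrite -subr_eq0 -oppr_eq0 -e /dWy; apply/eqP; ring.
rewrite loc_val_opp // => /(congr1 snd) /= /eqP; rewrite -subr_eq0 => /eqP e.
by apply/eqP; rewrite -oppr_eq0 -e /dWy; apply/eqP; ring.
Qed.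

(** If A and B do not both vanish at the abscissa of R, then A + B y cannot vanish
    at both R and - R unless R = - R.  So the whole multiplicity of the norm at
    that abscissa is carried by R. *)
Lemma hord_prim R A B m M : R <> pt0 W ->
  (A.[(loc_val R).1] != 0) || (B.[(loc_val R).1] != 0) -> evreg R A B = 0 ->
  xnorm W A B = ('X - (loc_val R).1%:P) ^+ m * M -> M.[(loc_val R).1] != 0 ->
  hord R (el A B) m.
Proof.
move=> R0 prim e eN nM.
have nB : B.[(loc_val R).1] != 0.
  apply: contraTneq prim => B0; rewrite B0 eqxx orbF negbK.
  by move: e; rewrite /evreg B0 mul0r addr0 => ->.
have eK : el A B * el (A - B * lin) (- B) = locx K R ^+ m * fpoly M.
  by rewrite regfun_xnorm eN rmorphM rmorphXn locxE.
have hM : hord R (fpoly M) 0 by apply: hord_unit nM (hasv_fpoly _ _ R0).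
case: (eqVneq (dWy R) 0) => n; last first.
  have nv : evreg R (A - B * lin) (- B) != 0.
    rewrite -evreg_opp //; apply: contra_neq n => e'.
    have : B.[(loc_val R).1] * dWy R = 0.
      rewrite -(subrr 0) -{1}e -e' /evreg loc_val_opp //= /dWy; ring.
    by move/eqP; rewrite mulf_eq0 (negPf nB) => /eqP.
  have hc := hasv_regfun K (A - B * lin) (- B) R0.
  have nc := hasv_neq0 nv hc.
  have -> : el A B = locx K R ^+ m * fpoly M / el (A - B * lin) (- B).
    by rewrite -eK mulfK.
  apply: (hord_divu nv hc); apply: (hord_mulu nM (hasv_fpoly K M R0)).
  by have := hordX m (hord_locx1 R0 n); rewrite pmulrn intz.
have h1 C D : D.[(loc_val R).1] != 0 -> evreg R C D = 0 -> hord R (el C D) 1.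
  move=> nD /(regfun_split K R0) [F ->].
  have nx := smooth_partials smooth R0 n.
  have hG := hasv_locG K R0; have nG := hasv_neq0 nx hG.
  have -> : locx K R = locy K R * (locS K R / locG K R) by rewrite mulrA locy_locS // mulfK.
  rewrite -mulrA -mulrDr.
  apply: (@hord_mulu _ _ _ _ _ _ _
    (dWy R / dWx R * F.[(loc_val R).1] + D.[(loc_val R).1])); last exact: hord_locy1.
    by rewrite n mul0r mul0r add0r.
  apply: hasvD (hasv_fpoly _ _ R0); apply: hasvM (hasv_fpoly _ _ R0).
  exact: hasvM (hasv_locS K R0) (hasvV nx hG).
have oR : opp_pt R = R by apply/eqP; rewrite -dWy_opp // n.
have ha : hord R (el A B) 1 by apply: h1.
have hb : hord R (el (A - B * lin) (- B)) 1.
  by apply: h1; rewrite -?evreg_opp ?oR // hornerN oppr_eq0.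
have h2 := hordM ha hb; rewrite eK in h2.
have h3 := hord_mulu nM (hasv_fpoly K M R0) (hordX m (hord_locx2 R0 n)).
by have -> : m = 1%N :> nat; [have := hord_uniq h2 h3; lia | exact: ha].
Qed.

Lemma hord_locz : hord (pt0 W) locz 1.
Proof.
apply: (hordI (unif_locz K) (hasv1 _ _) (oner_neq0 _)).
by rewrite expr1z mulr1.
Qed.

Lemma hord_yfun : hord (pt0 W) yfun (- 3%:Z).
Proof.
have hU := hasv_locU K; have nU := hasv_neq0 (oner_neq0 _) hU.
have -> : yfun = (locz ^+ 3 / locU)^-1 by rewrite -locwU mulfK // invrK.
apply: hordV => //; apply: (hord_divu (oner_neq0 _) hU).
by have := hordX 3 hord_locz.
Qed.

Lemma hord_xfun : hord (pt0 W) gx (- 2%:Z).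
Proof.
have -> : gx = locz * yfun by rewrite /locz divfK // yfun_neq0.
exact: (hordM hord_locz hord_yfun).
Qed.

Lemma hord_eq R (f : K) (m n : int) : m = n -> hord R f m -> hord R f n.
Proof. by move=> ->. Qed.

Lemma hord_infty_fpoly A : A != 0 ->
  hord (pt0 W) (fpoly A) (- (2 * (size A).-1)%N%:Z).
Proof.
elim/poly_ind: A => [|A c IH]; first by rewrite eqxx.
rewrite rmorphD rmorphM size_MXaddC -/(fcst c) -/gx.
case: (eqVneq A 0) => [->|nA] /=.
  rewrite rmorph0 !mul0r !add0r polyC_eq0 => nc; rewrite (negPf nc) /=.
  by rewrite size_poly0; apply: hord_eq (hord_cst K (pt0 W) nc).
move=> _; have h := hordM (IH nA) hord_xfun.
have sA : (0 < size A)%N by rewrite size_poly_gt0.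
have {}h : hord (pt0 W) (fpoly A * gx) (- (2 * size A)%N%:Z) by apply: hord_eq h; lia.
case: (eqVneq c 0) => [->|nc]; first by rewrite rmorph0 addr0.
by apply: hordD h (hord_cst K _ nc) _; lia.
Qed.

(** A and B y have orders of different parity at infinity, so no cancellation
    occurs: the order of A + B y there is minus the larger weight, which is also
    the degree of the norm.  No such weight equals 1, which is why no function
    has a single simple pole. *)
Lemma hord_infty_regfun A B : el A B != 0 -> exists d : nat,
  [/\ hord (pt0 W) (el A B) (- d%:Z), size (xnorm W A B) = d.+1, d != 1%N
    & d = 0%N -> exists c, el A B = fcst c].
Proof.
have hB : B != 0 -> hord (pt0 W) (fpoly B * yfun) (- (2 * (size B).-1 + 3)%N%:Z).
  by move=> nB; apply: hord_eq (hordM (hord_infty_fpoly nB) hord_yfun); lia.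
have [sc sl] := (size_weq_cub W, size_lin W).
have nc : cub != 0 by rewrite -size_poly_eq0 sc.
move=> nAB; case: (eqVneq B 0) => [B0|nB].
  move: nAB; rewrite B0 -fpoly_regfun fpoly_eq0 => nA.
  have sA : (0 < size A)%N by rewrite size_poly_gt0.
  exists (2 * (size A).-1)%N; split; first exact: hord_infty_fpoly.
  - rewrite /xnorm mulr0 expr0n !mul0r !subr0 expr2 size_mul //.
    by move: sA; case: (size A) => // n _; lia.
  - lia.
  - move=> s0; have /size_poly1P [c _ ->] : size A == 1%N by lia.
    by exists c.
have sB : (0 < size B)%N by rewrite size_poly_gt0.
have sBc : size (B ^+ 2 * cub) = (2 * size B + 2)%N.
  by rewrite size_mul ?expf_neq0 // sc expr2 size_mul //; move: sB; case: (size B) => // n _; lia.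
case: (eqVneq A 0) => [A0|nA].
  exists (2 * (size B).-1 + 3)%N; rewrite A0 /regfun rmorph0 add0r; split; try lia.
    exact: hB.
  rewrite /xnorm mul0r mul0r expr0n /= subr0 sub0r size_polyN sBc.
  by case: (size B) sB => // n _; lia.
have sA : (0 < size A)%N by rewrite size_poly_gt0.
have sAA : size (A ^+ 2) = (2 * size A).-1.
  by rewrite expr2 size_mul //; case: (size A) => // n; lia.
have sAB : (size (A * B * lin)%R <= size A + size B)%N.
  have := size_mul_le (leqnn (size (A * B)%R)) sl; rewrite (size_mul nA nB) => h.
  apply: leq_trans h _; move: sA sB; move: (size A) (size B) => a b; lia.
have sS : (size (A * B * lin + B ^+ 2 * cub)%R <= maxn (size A + size B) (2 * size B + 2))%N.
  by rewrite (leq_trans (size_polyD _ _)) // sBc geq_max !leq_max sAB leqnn orbT.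
have hA := hord_infty_fpoly nA; have {}hB := hB nB.
rewrite /xnorm -addrA -opprD.
move: sAA sAB sBc sS hA hB sA sB; move: (size A) (size B) => a b.
move=> sAA sAB sBc sS hA hB sA sB.
case: (leqP a b.+1) => cmp.
  exists (2 * b.-1 + 3)%N; split; try lia.
    by rewrite /regfun addrC; apply: hordD hB hA _; lia.
  have e1 : size (A * B * lin + B ^+ 2 * cub) = (2 * b + 2)%N.
    by rewrite addrC size_polyDl sBc //; apply: leq_ltn_trans sAB _; lia.
  by rewrite addrC size_polyDl size_polyN e1 ?sAA; lia.
exists (2 * a.-1)%N; split; try lia.
  by apply: hordD hA hB _; lia.
rewrite size_polyDl ?size_polyN sAA; first by lia.
by apply: leq_ltn_trans sS _; lia.
Qed.

End AffineOrders.

Section Regular.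
Variables (k : closedFieldType) (E : ellcurve k) (K : funmodel E).
Local Notation W := (weq E).
Local Notation fpoly := (fpol K).
Local Notation el := (regfun K).

Lemma closed_quadratic (F : closedFieldType) (b c : F) : exists x, x ^+ 2 + b * x = c.
Proof.
have [x] := @solve_monicpoly F 2 (fun i => if i == 0%N then c else - b) isT.
rewrite big_ord_recl big_ord1 /= expr0 expr1 mulr1 mulNr => e.
by exists x; rewrite e subrK.
Qed.

Lemma point_above x : exists R : point W, R <> pt0 W /\ (loc_val R).1 = x.
Proof.
have [y e] := closed_quadratic (a1 W * x + a3 W) (x ^+ 3 + a2 W * x ^+ 2 + a4 W * x + a6 W).
have h : on_curve W (Some (x, y)) by apply/eqP; rewrite -e; ring.
by exists (Point h); split=> // /(congr1 (@coords _ _)).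
Qed.

(** The denominators d(x) of f form an ideal of k[x].  Given a root x0 of d, the
    regularity of f at the points R and - R above x0 gives a denominator in k[x, y]
    that vanishes at neither; its norm is a denominator that does not vanish at x0,
    and the gcd with d is a smaller denominator. *)
Lemma regular_regfun (f : K) : (forall R, R <> pt0 W -> exists c, hasv R f c) ->
  exists A B, f = el A B.
Proof.
move=> reg; have [A [B [d [nd e]]]] := fpol_gen f.
have {A B e} : exists A B, f * fpoly d = el A B by exists A, B.
have [n] := ubnP (size d); elim: n d nd => // n IH d nd sd den.
case: (leqP (size d) 1) => [s1|s1].
  have /size_poly1P [c nc dE] : size d == 1%N.
    by rewrite eqn_leq s1 size_poly_gt0.
  have [A [B eA]] := den; exists (c^-1%:P * A), (c^-1%:P * B).
  rewrite -regfunPM -eA dE mulrCA -rmorphM -polyCM mulVf // polyC1 rmorph1 mulr1 //.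
have /closed_rootP [x0 rx] : size d != 1%N by rewrite neq_ltn s1 orbT.
suff [q [nq [A [B eq]]]] : exists q, q.[x0] != 0 /\ exists A B, f * fpoly q = el A B.
  have [u] := Bezoutp d q => gE; have [C [D eC]] := den.
  have ng : (u.1 * d + u.2 * q).[x0] != 0.
    have /eqp_root gr := gE; rewrite -rootE gr root_gcd rx /=.
    by rewrite rootE.
  apply: (IH (u.1 * d + u.2 * q)).
  - by apply: contraNneq ng => ->; rewrite horner0.
  - rewrite ltnS in sd; apply: leq_trans sd; rewrite (eqp_size gE).
    rewrite ltn_neqAle dvdp_leq ?dvdp_gcdl // andbT.
    apply/negP => sg; have := dvdp_size_eqp (dvdp_gcdl d q); rewrite sg => /esym eg.
    have /eqp_root := eqp_trans gE eg => /(_ x0); rewrite rx => /rootP e0.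
    by rewrite e0 eqxx in ng.
  - exists (u.1 * C + u.2 * A), (u.1 * D + u.2 * B).
    by rewrite -regfunD -!regfunPM -eC -eq rmorphD !rmorphM; ring.
have [R [R0 Rx]] := point_above x0.
have oR0 : opp_pt R <> pt0 W by rewrite opp_pt_eq0.
have key T : T <> pt0 W -> exists C D, evreg T C D != 0 /\ exists A B, f * el C D = el A B.
  move=> T0; have [c [p [q [nq fq _]]]] := reg T T0.
  have [A [B [eA _]]] := affine_eval K p T0; have [C [D [eC vC]]] := affine_eval K q T0.
  by exists C, D; rewrite -vC; split=> //; exists A, B; rewrite -eC fq.
suff [C [D [n1 [n2 [A [B e]]]]]] : exists C D, evreg R C D != 0 /\ 
   (evreg (opp_pt R) C D != 0 /\ exists A B, f * el C D = el A B).
  exists (xnorm W C D); split; first by rewrite -Rx xnorm_horner // mulf_neq0.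
  by rewrite -regfun_xnorm mulrA e regfunM; eexists; eexists.
have [C [D [n1 [A [B e]]]]] := key R R0; have [C' [D' [n2 [A' [B' e']]]]] := key _ oR0.
case: (eqVneq (evreg (opp_pt R) C D) 0) => z1; last first.
  by exists C, D; split=> //; split=> //; exists A, B.
case: (eqVneq (evreg R C' D') 0) => z2; last first.
  by exists C', D'; split=> //; split=> //; exists A', B'.
have evD T : evreg T (C + C') (D + D') = evreg T C D + evreg T C' D'.
  by rewrite /evreg !hornerD; ring.
exists (C + C'), (D + D'); rewrite !evD z1 z2 addr0 add0r; split=> //; split=> //.
by exists (A + A'), (B + B'); rewrite -!regfunD mulrDr e e'.
Qed.

End Regular.

(** * Divisors and the group law *)

Lemma prod_XsubC_count (k : fieldType) (s : seq k) x :
  exists2 M : {poly k}, \prod_(z <- s) ('X - z%:P) = ('X - x%:P) ^+ count_mem x s * M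
    & M.[x] != 0.
Proof.
elim: s => [|z s [M e nM]]; first by exists 1; rewrite ?big_nil ?hornerC ?mulr1 ?oner_eq0.
rewrite big_cons e /=; case: (eqVneq z x) => [->|nz].
  by exists M; rewrite // add1n exprS mulrA.
exists (('X - z%:P) * M); first by rewrite add0n mulrCA.
by rewrite hornerM hornerXsubC mulf_neq0 // subr_eq0 eq_sym.
Qed.

Section Divisors.
Variables (k : fieldType) (E : ellcurve k) (K : funmodel E).
Local Notation W := (weq E).
Local Notation lin := (weq_lin W).
Local Notation cub := (weq_cub W).
Local Notation fpoly := (fpol K).
Local Notation el := (regfun K).
Local Notation fcst := (cstfun K).
Local Notation px R := (loc_val R).1.
Local Notation py R := (loc_val R).2.
Implicit Types (R A B C P Q : point W) (f g : K) (D : point W -> int).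

Lemma hord_roots R (A B : {poly k}) c (s : seq k) : R <> pt0 W -> c != 0 ->
  xnorm W A B = c *: \prod_(z <- s) ('X - z%:P) ->
  (A.[px R] != 0) || (B.[px R] != 0) ->
  hord R (el A B) (if evreg R A B == 0 then (count_mem (px R) s)%:Z else 0).
Proof.
move=> R0 nc eN prim; case: eqP => [e|/eqP n]; last exact: hord_unit n (hasv_regfun _ _ _ R0).
have [M eM nM] := prod_XsubC_count s (px R).
apply: (@hord_prim _ _ K _ _ _ _ (c *: M)) => //; first by rewrite eN eM scalerAr.
by rewrite hornerZ mulf_neq0.
Qed.

Definition hdiv f D := forall R, hord R f (D R).
Definition dirac A R : int := (R == A : nat).

Lemma hdivM f g D D' : hdiv f D -> hdiv g D' -> hdiv (f * g) (fun R => D R + D' R).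
Proof. by move=> hf hg R; apply: hordM. Qed.
Lemma hdivV f D : hdiv f D -> hdiv f^-1 (fun R => - D R).
Proof. by move=> hf R; apply: hordV. Qed.
Lemma hdivX f D n : hdiv f D -> hdiv (f ^+ n) (fun R => D R *+ n).
Proof. by move=> hf R; apply: hordX. Qed.
Lemma hdiv_ext f D D' : D =1 D' -> hdiv f D -> hdiv f D'.
Proof. by move=> e hf R; rewrite -e. Qed.

Definition principal D := exists f, hdiv f D.
Lemma hdiv_principal f D : hdiv f D -> principal D.
Proof. by exists f. Qed.
Lemma principalB D D' D'' : (forall R, D'' R = D R - D' R) ->
  principal D -> principal D' -> principal D''.
Proof.
move=> e [f hf] [g /hdivV hg]; exists (f / g) => R; rewrite e; exact: hordM (hf R) (hg R).
Qed.
Lemma principalD D D' D'' : (forall R, D'' R = D R + D' R) ->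
  principal D -> principal D' -> principal D''.
Proof.
move=> e [f hf] [g hg]; exists (f * g) => R; rewrite e; exact: hordM (hf R) (hg R).
Qed.
Lemma principal0 D : (forall R, D R = 0) -> principal D.
Proof. by move=> e; exists 1 => R; rewrite e; exact: hord1. Qed.

Lemma dirac_eq A R : R = A -> dirac A R = 1. Proof. by move->; rewrite /dirac eqxx. Qed.
Lemma dirac_neq A R : R <> A -> dirac A R = 0. Proof. by move/eqP/negPf => e; rewrite /dirac e. Qed.

Lemma hdiv_vertical A : A <> pt0 W ->
  hdiv (locx K A) (fun R => dirac A R + dirac (opp_pt A) R - 2 * dirac (pt0 W) R).
Proof.
move=> A0 R; have oA0 : opp_pt A <> pt0 W by rewrite opp_pt_eq0.
case: (eqVneq R (pt0 W)) => [->|/eqP R0].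
  rewrite (dirac_neq (nesym A0)) (dirac_neq (nesym oA0)) (dirac_eq (erefl _)) locxE.
  have n : 'X - (px A)%:P != 0 :> {poly k} by rewrite polyXsubC_eq0.
  by have := hord_infty_fpoly K n; rewrite size_XsubC.
rewrite (dirac_neq R0) mulr0 subr0.
case: (eqVneq (px R) (px A)) => [ex|nx]; last first.
  rewrite !dirac_neq; last by move=> e; move: nx; rewrite e eqxx.
    apply: (@hord_unit _ _ _ _ _ (px R - px A)); first by rewrite subr_eq0.
    by apply: hasvB (hasv_xfun _ R0) (hasvC _ _ _).
  by move=> e; move: nx; rewrite e loc_val_opp // eqxx.
have -> : locx K A = locx K R by rewrite !locxE ex.
have := hord_locx K R0; rewrite dWy_opp //.
have [->|->] := same_x_opp R0 A0 ex; rewrite ?opp_ptK.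
  rewrite (dirac_eq (erefl _)) /dirac eq_sym; by case: (R == _).
rewrite [dirac R R](dirac_eq (erefl _)) /dirac eq_sym; by case: (R == _).
Qed.

(** After division by x - x(A), the equation of the intersection of the curve with
    the line of slope l through A is a quadratic equation in x; it has the root
    x(B).  For the tangent this is the definition of the slope. *)
Lemma chord_quadratic A B (l := chord_slope W (px A) (py A) (px B) (py B)) :
  A <> pt0 W -> B <> pt0 W -> B <> opp_pt A ->
  py B = py A + l * (px B - px A) /\
  px B ^+ 2 + px B * px A + px A ^+ 2 + a2 W * (px B + px A) + a4 W
    - l * (2%:R * py A + l * (px B - px A)) - a1 W * (py A + l * px B) - a3 W * l = 0.
Proof.
move=> A0 B0 nB; have [eA eB] := (weq_loc A0, weq_loc B0).
rewrite /= in eA eB; rewrite {}/l /chord_slope.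
case: eqP => [ex|/eqP nx].
  have [eBA|] := same_x_opp A0 B0 ex; last by [].
  have nz : 2%:R * py A + a1 W * px A + a3 W != 0.
    apply/eqP => z; apply: nB; rewrite eBA; apply/esym/eqP; rewrite -dWy_opp //.
    by apply/eqP.
  by rewrite eBA subrr mulr0 addr0; split=> //; field.
have d : px B - px A != 0 by rewrite subr_eq0 eq_sym.
set m := _ / _; have my : m * (px B - px A) = py B - py A by rewrite /m divfK.
have yE : py B = py A + m * (px B - px A) by rewrite my; ring.
split=> //; apply: (mulfI d); rewrite mulr0.
move: eA eB => /eqP; rewrite -subr_eq0 => /eqP eA /eqP; rewrite -subr_eq0 => /eqP eB.
have <- : 0 - 0 = 0 :> k by rewrite subrr.
by rewrite -{1}eA -{1}eB yE; ring.
Qed.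

(** [regfun (line l m) 1] is the function y - l x - m. *)
Definition line (l m : k) : {poly k} := - (l *: 'X + m%:P).

Lemma evreg_line l m R : evreg R (line l m) 1 = py R - l * px R - m.
Proof. by rewrite /evreg /line !hornerE; ring. Qed.

(** The norm of y - l x - m is minus the cubic whose roots are the abscissas of
    the three intersection points. *)
Lemma xnorm_line A B l m (x3 := l ^+ 2 + a1 W * l - a2 W - px A - px B) :
  A <> pt0 W -> py A = l * px A + m ->
  px B ^+ 2 + px B * px A + px A ^+ 2 + a2 W * (px B + px A) + a4 W
    - l * (2%:R * py A + l * (px B - px A)) - a1 W * (py A + l * px B) - a3 W * l = 0 ->
  xnorm W (line l m) 1 = (-1) *: \prod_(z <- [:: px A; px B; x3]) ('X - z%:P).
Proof.
move=> A0 eY eQ; rewrite !big_cons big_nil mulr1 scaleN1r.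
have /= /eqP := weq_loc A0; rewrite -subr_eq0 => /eqP eA.
move: (congr1 polyC eA) (congr1 polyC eQ); rewrite polyC0 eY /x3.
rewrite /xnorm /line /weq_lin /weq_cub -!mul_polyC !(polyCD, polyCB, polyCN, polyCM, polyC_exp).
move: (px A)%:P (px B)%:P l%:P m%:P (a1 W)%:P (a2 W)%:P (a3 W)%:P (a4 W)%:P (a6 W)%:P.
move=> a b L M A1 A2 A3 A4 A6 e1 e2.
apply/eqP; rewrite -subr_eq0; apply/eqP.
(* dividing the cubic by 'X - a and the quotient by 'X - b leaves the
   remainders e1 and e2 *)
have -> : 0 = 0 - ('X - a) * 0 :> {poly k} by rewrite mulr0 subr0.
rewrite -{1}e1 -e2; ring.
Qed.

Lemma add_coordsE A B (l := chord_slope W (px A) (py A) (px B) (py B))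
    (x3 := l ^+ 2 + a1 W * l - a2 W - px A - px B) :
  A <> pt0 W -> B <> pt0 W -> B <> opp_pt A ->
  coords (add_pt A B) = Some (x3, - (l * (x3 - px A) + py A) - a1 W * x3 - a3 W).
Proof.
rewrite {}/x3 {}/l; case: A => [[[x1 y1]|] hA]; last by case; apply: val_inj.
case: B => [[[x2 y2]|] hB] _; last by case; apply: val_inj.
move=> _ nB /=; case: ifP => // /andP [/eqP ex /eqP ey]; case: nB.
apply: val_inj; rewrite /= ex; congr (Some (_, _)).
by apply/eqP; rewrite -subr_eq0; apply/eqP; rewrite -[RHS]ey; ring.
Qed.

(** The order at R of y - l x - m is the multiplicity of x(R) in the norm when the
    function vanishes at R, and a line that is not vertical determines the point
    from the abscissa. *)
Lemma hdiv_line A B (l := chord_slope W (px A) (py A) (px B) (py B)) (m := py A - l * px A) :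
  A <> pt0 W -> B <> pt0 W -> B <> opp_pt A ->
  add_pt A B <> pt0 W /\
  hdiv (el (line l m) 1) (fun R => dirac A R + dirac B R + dirac (opp_pt (add_pt A B)) R
    - 3 * dirac (pt0 W) R).
Proof.
move=> A0 B0 nB; have [eB eQ] := chord_quadratic A0 B0 nB.
rewrite -/l in eB eQ.
pose x3 := l ^+ 2 + a1 W * l - a2 W - px A - px B.
have eC : coords (add_pt A B) =
    Some (x3, - (l * (x3 - px A) + py A) - a1 W * x3 - a3 W).
  exact: add_coordsE.
have C0 : add_pt A B <> pt0 W by move=> e; rewrite e in eC.
split=> // R.
set T := opp_pt (add_pt A B); have T0 : T <> pt0 W by rewrite opp_pt_eq0.
have Tx : px T = x3 by rewrite loc_val_opp //= /loc_val eC.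
have Ty : py T = l * (x3 - px A) + py A.
  by rewrite loc_val_opp //= /loc_val eC /=; ring.
have mE : py A = l * px A + m by rewrite /m; ring.
have eN := xnorm_line A0 mE eQ; rewrite -/x3 in eN.
have n1 : (-1 : k) != 0 by rewrite oppr_eq0 oner_eq0.
have nz : el (line l m) 1 != 0 by rewrite regfun_neq0 oner_eq0 orbT.
case: (eqVneq R (pt0 W)) => [->|/eqP R0].
  have [d [hd sN _ _]] := hord_infty_regfun nz.
  rewrite (dirac_neq (nesym A0)) (dirac_neq (nesym B0)) (dirac_neq (nesym T0)) (dirac_eq (erefl _)).
  apply: hord_eq hd.
  have : size (xnorm W (line l m) 1) = 4%N by rewrite eN size_scale ?n1 // size_prod_XsubC.
  by rewrite sN => -[->].
rewrite (dirac_neq R0) mulr0 subr0.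
have prim : ((line l m).[px R] != 0) || ((1 : {poly k}).[px R] != 0).
  by rewrite hornerC oner_eq0 orbT.
have := @hord_roots R _ _ _ _ R0 n1 eN prim; rewrite evreg_line.
have onA : py A - l * px A - m = 0 by rewrite /m; ring.
have onB : py B - l * px B - m = 0 by rewrite eB /m; ring.
have onT : py T - l * px T - m = 0 by rewrite Ty Tx /m; ring.
case: eqP => [eR|nR]; last first.
  by rewrite !dirac_neq // => e; apply: nR; rewrite e.
have same P : P <> pt0 W -> py P - l * px P - m = 0 -> (px P == px R : nat) = dirac P R :> int.
  move=> P0 eP; rewrite /dirac; congr (Posz (nat_of_bool _)); apply/eqP/eqP => [ex|-> //].
  apply: loc_val_inj => //; rewrite [LHS]surjective_pairing [RHS]surjective_pairing ex.
  congr (_, _); apply/eqP; rewrite -subr_eq0; apply/eqP.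
  by rewrite -[RHS](subrr 0) -{1}eR -eP ex; ring.
rewrite -(same A A0 onA) -(same B B0 onB) -(same T T0 onT) Tx /=.
by apply: hord_eq; lia.
Qed.

Lemma add_pt_opp A : add_pt A (opp_pt A) = pt0 W.
Proof.
apply: val_inj; case: A => [[[x y]|] h] //=.
rewrite eqxx /=; case: eqP => //; case; ring.
Qed.
Lemma add_pt0l A : add_pt (pt0 W) A = A. Proof. exact: val_inj. Qed.
Lemma add_pt0r A : add_pt A (pt0 W) = A.
Proof. by apply: val_inj; case: A => [[[x y]|] h]. Qed.

Lemma add_pt_eq0 A B : add_pt A B = pt0 W -> B = opp_pt A.
Proof.
case: (eqVneq A (pt0 W)) => [->|/eqP A0]; first by rewrite add_pt0l opp_pt0.
case: (eqVneq B (pt0 W)) => [->|/eqP B0]; first by rewrite add_pt0r.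
case: (eqVneq B (opp_pt A)) => [//|/eqP nB].
by have [] := hdiv_line A0 B0 nB.
Qed.

Lemma principal_add A B :
  principal (fun R => dirac A R + dirac B R - dirac (add_pt A B) R - dirac (pt0 W) R).
Proof.
case: (eqVneq A (pt0 W)) => [->|/eqP A0].
  by rewrite add_pt0l; apply: principal0 => R; ring.
case: (eqVneq B (pt0 W)) => [->|/eqP B0].
  by rewrite add_pt0r; apply: principal0 => R; ring.
case: (eqVneq B (opp_pt A)) => [->|/eqP nB].
  rewrite add_pt_opp; exists (locx K A); apply: hdiv_ext (hdiv_vertical A0) => R; ring.
have [C0 h] := hdiv_line A0 B0 nB.
by apply: (principalB _ (hdiv_principal h) (hdiv_principal (hdiv_vertical C0))) => R; ring.
Qed.

End Divisors.

Section GroupLaw.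
Variables (k : closedFieldType) (E : ellcurve k).
Local Notation W := (weq E).
Local Notation K := (funfield_model W).
Implicit Types (R A B C P Q : point W).

(** A function with this divisor would be a polynomial in x and y with a simple
    pole at infinity. *)
Lemma principal_point0 (K : funmodel E) C :
  principal K (fun R => dirac C R - dirac (pt0 W) R) -> C = pt0 W.
Proof.
move=> [f hf]; case: (eqVneq C (pt0 W)) => // /eqP C0.
have [A [B fE]] : exists a b : {poly k}, f = regfun K a b.
  apply: regular_regfun => R R0; apply: (hord_ge0 _ (hf R)).
  by rewrite (dirac_neq R0) subr0 /dirac.
have := hf (pt0 W); rewrite (dirac_neq (nesym C0)) (dirac_eq (erefl _)) fE => h.
have [d [hd _ d1 _]] := hord_infty_regfun (hord_neq0 h).
by have := hord_uniq h hd; lia.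
Qed.

(** Points embed into the divisor class group; since chord-and-tangent addition
    becomes addition of classes ([principal_add]), the group axioms follow. *)
Lemma principal_inj (K : funmodel E) A B :
  principal K (fun R => dirac A R - dirac B R) -> A = B.
Proof.
move=> h; have h1 := principal_add K A (opp_pt B); have h2 := principal_add K B (opp_pt B).
rewrite add_pt_opp in h2.
have C0 : add_pt A (opp_pt B) = pt0 W.
  apply: (principal_point0 (principalB _ (principalD (fun R => erefl _) h h2) h1)) => R.
  ring.
by have /(congr1 (@opp_pt _ _)) := add_pt_eq0 K C0; rewrite !opp_ptK.
Qed.

Lemma add_ptC : commutative (@add_pt k W).
Proof.
move=> A B; apply: (@principal_inj K).
by apply: (principalB _ (principal_add K B A) (principal_add K A B)) => R; ring.
Qed.

Lemma add_ptA : associative (@add_pt k W).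
Proof.
move=> A B C; apply: (@principal_inj K).
have h1 := principalD (fun R => erefl _) (principal_add K B C) (principal_add K A (add_pt B C)).
have h2 := principalD (fun R => erefl _) (principal_add K A B) (principal_add K (add_pt A B) C).
by apply: (principalB _ h2 h1) => R; ring.
Qed.

Lemma add_ptN : left_inverse (pt0 W) (@opp_pt k W) (@add_pt k W).
Proof. by move=> A; rewrite add_ptC add_pt_opp. Qed.

End GroupLaw.

HB.instance Definition _ (k : closedFieldType) (E : ellcurve k) :=
  GRing.isZmodule.Build (point (weq E)) (@add_ptA k E) (@add_ptC k E)
    (@add_pt0l k E) (@add_ptN k E).

Section GroupLawTheory.
Variables (k : closedFieldType) (E : ellcurve k).
Local Notation W := (weq E).
Implicit Types (A B P : point E).

Lemma pt0E : pt0 E = 0 :> point E. Proof. by []. Qed.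
Lemma add_ptE A B : add_pt A B = A + B. Proof. by []. Qed.
Lemma opp_ptE A : opp_pt A = - A. Proof. by []. Qed.
Lemma mul_ptE n P : mul_pt n P = P *+ n.
Proof. by elim: n => // n IH; rewrite mulrS -IH. Qed.

Lemma principal_mul (K : funmodel E) P n :
  principal K (fun R => n%:Z * dirac P R - dirac (P *+ n) R - (n%:Z - 1) * dirac (pt0 W) R).
Proof.
elim: n => [|n IH]; first by apply: principal0 => R; rewrite mulr0n pt0E; ring.
apply: (principalD _ IH (principal_add K P (P *+ n))) => R.
by rewrite mulrS add_ptE -addn1 PoszD; ring.
Qed.
End GroupLawTheory.

(** * The zeros of a function *)

Section ZeroLists.
Variables (k : closedFieldType) (E : ellcurve k) (K : funmodel E).
Local Notation W := (weq E).
Local Notation lin := (weq_lin W).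
Local Notation cub := (weq_cub W).
Local Notation el := (regfun K).
Local Notation px R := (loc_val R).1.
Local Notation py R := (loc_val R).2.
Implicit Types (R T P : point E) (A B : {poly k}).

(** The divisor of zeros, as a list in which each point is repeated according to its
    multiplicity. *)
Definition zeros A B (s : seq (point E)) :=
  [/\ forall R, R \in s -> R <> pt0 E,
      forall R, R <> pt0 E -> hord R (el A B) (count_mem R s)
    & hord (pt0 E) (el A B) (- (size s)%:Z)].

Lemma zero_above A B x : root (xnorm W A B) x ->
  exists R : point E, [/\ R <> pt0 E, px R = x & evreg R A B = 0].
Proof.
move/rootP; have [R [R0 <-]] := point_above E x; rewrite xnorm_horner //.
move/eqP; rewrite mulf_eq0 => /orP [] /eqP e; first by exists R.
by exists (opp_pt R); split=> //; [rewrite opp_pt_eq0 | rewrite loc_val_opp].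
Qed.

Lemma prim_unique A B R : R <> pt0 E -> (A.[px R] != 0) || (B.[px R] != 0) ->
  evreg R A B = 0 -> evreg (opp_pt R) A B = 0 -> opp_pt R = R.
Proof.
move=> R0 prim e e'; apply/eqP; rewrite -dWy_opp //.
have nB : B.[px R] != 0.
  apply: contraTneq prim => B0; rewrite B0 eqxx orbF negbK.
  by move: e; rewrite /evreg B0 mul0r addr0 => ->.
have : B.[px R] * dWy R = 0.
  by rewrite -(subrr 0) -{1}e -e' /evreg loc_val_opp //= /dWy; ring.
by move/eqP; rewrite mulf_eq0 (negPf nB).
Qed.

Lemma zeros_prim A B : el A B != 0 ->
  (forall x, (A.[x] != 0) || (B.[x] != 0)) -> exists s, zeros A B s.
Proof.
move=> nz prim; have nN := xnorm_neq0 nz.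
have [r eN] := closed_field_poly_normal (xnorm W A B).
have nl : lead_coef (xnorm W A B) != 0 by rewrite lead_coef_eq0.
have [s [sr s0]] : exists s : seq (point E), map (fun R => px R) s = r /\
    forall R, R \in s -> R <> pt0 E /\ evreg R A B = 0.
  have : forall x, x \in r -> root (xnorm W A B) x.
    by move=> x xr; rewrite eN rootZ // root_prod_XsubC.
  elim: r {eN} => [|x r IH] h; first by exists [::].
  have [s [sr s0]] := IH (fun y yr => h y (mem_behead (s := x :: r) yr)).
  have [R [R0 Rx eR]] := zero_above (h x (mem_head _ _)).
  exists (R :: s); rewrite /= Rx sr; split=> // T; rewrite inE => /predU1P [->|] //.
  exact: s0.
exists s; split=> [R /s0 [] //|R R0|].
  have := hord_roots K R0 nl eN (prim _); rewrite -sr.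
  case: eqP => [eR|nR]; apply: hord_eq; congr Posz.
    rewrite count_map; apply: eq_in_count => T Ts /=; apply/eqP/eqP => [ex|-> //].
    have [T0 eT] := s0 T Ts; have [->|e'] := same_x_opp R0 T0 (esym ex) => //.
    by rewrite e'; apply: prim_unique (prim _) eR _ => //; rewrite -e'.
  apply/esym/count_memPn; apply/negP => Rs; exact: nR (s0 R Rs).2.
have [d [hd sN _ _]] := hord_infty_regfun nz; apply: hord_eq hd; congr (- Posz _).
by apply/eqP; rewrite -eqSS -sN eN size_scale // size_prod_XsubC -sr size_map.
Qed.

(** Common linear factors of A and B contribute the pairs R, - R; once they are
    removed the zeros are read off from the roots of the norm. *)
Lemma zeros_exist A B : el A B != 0 -> exists s, zeros A B s.
Proof.
have [n] := ubnP (size A + size B)%N; elim: n A B => // n IH A B sn nz.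
case: (eqVneq (size (gcdp A B)) 1%N) => [g1|/closed_rootP [x]].
  apply: zeros_prim => // x; rewrite -negb_and; apply/negP => /andP [/eqP Ax /eqP Bx].
  have : root (gcdp A B) x by rewrite root_gcd /root Ax Bx eqxx.
  have /size_poly1P [c nc ->] : size (gcdp A B) == 1%N by rewrite g1.
  by rewrite rootC (negPf nc).
rewrite root_gcd => /andP [/factor_theorem [A' eA] /factor_theorem [B' eB]].
have [R [R0 Rx]] := point_above E x.
have eE : el A B = locx K R * el A' B' by rewrite locxE regfunPM Rx eA eB ![_ * ('X - _)]mulrC.
have nz' : el A' B' != 0 by apply: contraNneq nz => e; rewrite eE e mulr0.
have [s [s0 sR sI]] : exists s, zeros A' B' s.
  apply: IH (nz'); rewrite ltnS in sn; apply: leq_trans sn; rewrite eA eB.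
  have szX (C : {poly k}) : size (C * ('X - x%:P)) = if C == 0 then 0%N else (size C).+1.
    case: eqVneq => [->|nC]; first by rewrite mul0r size_poly0.
    by rewrite size_Mmonic ?monicXsubC // size_XsubC addn2.
  move: nz'; rewrite !szX regfun_neq0; case: (eqVneq A' 0) => [->|_];
    by case: (eqVneq B' 0) => [->|_] //; rewrite ?size_poly0 => _; lia.
have hv := hdiv_vertical K R0.
have oR0 : opp_pt R <> pt0 E by rewrite opp_pt_eq0.
exists [:: R, opp_pt R & s]; split=> [T|T T0|].
- by rewrite !inE => /or3P [/eqP -> | /eqP -> | /s0].
- rewrite eE; apply: hord_eq (hordM (hv T) (sR T T0)).
  by rewrite (dirac_neq T0) /dirac /= ![_ == T]eq_sym; lia.
- rewrite eE; apply: hord_eq (hordM (hv (pt0 E)) sI).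
  by rewrite (dirac_neq (nesym R0)) (dirac_neq (nesym oR0)) (dirac_eq (erefl _)) /=; lia.
Qed.

End ZeroLists.

(** * The reflection z -> P - z *)

Section Reflection.
Variables (k : closedFieldType) (E : ellcurve k).
Local Notation W := (weq E).
Local Notation K := (funfield_model E).
Local Notation px R := (loc_val R).1.
Local Notation py R := (loc_val R).2.
Implicit Types (R T z : point E) (A B : {poly k}).

(** Reduction of F(u, x) modulo a monic quadratic polynomial in x whose
    coefficients are polynomials in u. *)
Lemma reduce_mod_quadratic (s1 s2 : {poly k}) (F : {poly {poly k}}) :
  exists al be : {poly k}, forall u x, x ^+ 2 = s1.[u] * x - s2.[u] ->
    F.[x%:P].[u] = al.[u] + be.[u] * x.
Proof.
elim/poly_ind: F => [|F c [al [be h]]].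
  by exists 0, 0 => u x _; rewrite !horner0 mul0r addr0.
exists (c - be * s2), (al + be * s1) => u x e.
rewrite hornerMXaddC !(hornerD, hornerN, hornerM) hornerC (h u x e).
transitivity (al.[u] * x + be.[u] * x ^+ 2 + c.[u]); first by ring.
by rewrite e; ring.
Qed.

(** The points z and P - z are the two further intersections of the curve with a
    line of some slope u through - P, and all slopes occur.  The product of the
    values of f = A + B y at these two points is a symmetric function of their
    abscissas, hence a polynomial in u.  Such a line does not meet P, the only zero
    of f, so this polynomial has no root and is constant. *)
Lemma reflection_product (P : point E) A B : P <> pt0 E -> opp_pt P <> P ->
  (forall R, R <> pt0 E -> evreg R A B = 0 -> R = P) ->
  exists2 c, c != 0 & forall z, z <> pt0 E -> z <> P ->
    evreg z A B * evreg (P - z) A B = c.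
Proof.
move=> P0 PP zP; pose a := px P; pose b := py (opp_pt P).
have oP0 : opp_pt P <> pt0 E by rewrite opp_pt_eq0.
have oPx : px (opp_pt P) = a by rewrite loc_val_opp.
(* on the line of slope u the abscissas of z and P - z are the roots of
   X^2 - s1(u) X + s2(u) *)
pose s1 : {poly k} := 'X ^+ 2 + (a1 W)%:P * 'X - (a2 W + a)%:P.
pose s2 : {poly k} := (a ^+ 2 + a2 W * a + a4 W - a1 W * b)%:P
  - (2%:R * b + a3 W)%:P * 'X + a%:P * 'X ^+ 2.
have s1E u : s1.[u] = u ^+ 2 + a1 W * u - a2 W - a by rewrite /s1 !hornerE; ring.
have s2E u : s2.[u] = a ^+ 2 + a2 W * a + a4 W - 2%:R * u * b + u ^+ 2 * a
    - a1 W * b - a3 W * u.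
  by rewrite /s2 !(hornerD, hornerN, hornerM, hornerC, hornerX, hornerXn); ring.
pose F : {poly {poly k}} := map_poly polyC A +
  map_poly polyC B * ('X * ('X)%:P + (b%:P - a%:P * 'X)%:P).
have FE x u : F.[x%:P].[u] = A.[x] + B.[x] * (u * x + (b - u * a)).
  rewrite /F hornerD hornerM !horner_map /= !hornerE /=; ring.
clearbody s1 s2 F.
have [al [be red]] := reduce_mod_quadratic s1 s2 F.
pose Pi := al ^+ 2 + al * be * s1 + be ^+ 2 * s2.
have PiE u x1 x2 : x1 + x2 = s1.[u] -> x1 * x2 = s2.[u] ->
    F.[x1%:P].[u] * F.[x2%:P].[u] = Pi.[u].
  move=> e1 e2; rewrite !red; try by rewrite -e1 -e2; ring.
  rewrite /Pi !(hornerD, hornerM, horner_exp) -e1 -e2; ring.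
have nPi u : Pi.[u] != 0.
  have [x1 q1] := closed_quadratic (- s1.[u]) (- s2.[u]).
  pose x2 := s1.[u] - x1.
  have q2 : x2 ^+ 2 + - s1.[u] * x2 = - s2.[u] by rewrite -q1 /x2; ring.
  have nF x : x ^+ 2 + - s1.[u] * x = - s2.[u] -> F.[x%:P].[u] != 0.
    move=> q; pose y := u * x + (b - u * a).
    have hz : on_curve W (Some (x, y)).
      have /= /eqP := weq_loc oP0; rewrite oPx -/b -subr_eq0 => /eqP eP.
      move/eqP: q; rewrite -subr_eq0 opprK => /eqP q.
      apply/eqP/eqP; rewrite -subr_eq0; apply/eqP.
      have -> : 0 = 0 - (x - a) * 0 :> k by rewrite mulr0 subr0.
      by rewrite -{1}eP -q s1E s2E /y; ring.
    have zE : loc_val (Point hz) = (x, y) by [].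
    rewrite FE; apply/eqP => e.
    have eP : Point hz = P.
      by apply: zP; [move/(congr1 (@coords _ _)) | rewrite /evreg zE].
    have xa : x = a by rewrite /a -eP zE.
    apply: PP; apply: loc_val_inj => //.
    rewrite [LHS]surjective_pairing [RHS]surjective_pairing oPx.
    by congr (_, _); rewrite -{2}eP zE -/b /= /y xa; ring.
  by rewrite -(PiE u x1 x2) ?mulf_neq0 ?nF // /x2; [ring | rewrite -[RHS]opprK -q1; ring].
have /size_poly1P [c nc Pic] : size Pi == 1%N.
  by apply/negPn/negP => /closed_rootP [u]; rewrite rootE (negPf (nPi u)).
exists c => // z z0 zP'.
have nz : z <> opp_pt (opp_pt P) by rewrite opp_ptK.
have [eB eQ] := chord_quadratic oP0 z0 nz.
have [C0 _] := hdiv_line K oP0 z0 nz; have eC := add_coordsE oP0 z0 nz.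
set l := chord_slope _ _ _ _ _ in eB eQ eC.
have -> : P - z = opp_pt (add_pt (opp_pt P) z) by rewrite opp_ptE add_ptE opp_ptE opprD opprK.
set T := opp_pt _; rewrite oPx -/b in eB eQ eC.
have Tx : px T = l ^+ 2 + a1 W * l - a2 W - a - px z by rewrite loc_val_opp //= /loc_val eC.
have Ty : py T = l * (px T - a) + b.
  by rewrite Tx loc_val_opp //= /loc_val eC /=; ring.
have -> : c = Pi.[l] by rewrite Pic hornerC.
rewrite -(PiE l (px z) (px T)).
- by rewrite !FE /evreg eB Ty; congr ((_ + _ * _) * (_ + _ * _)); ring.
- by rewrite s1E Tx; ring.
- by rewrite s2E Tx -[RHS]subr0 -eQ; ring.
Qed.

End Reflection.

(** The points that are not fixed are paired off by the involution. *)
Lemma odd_size_fixed_points (T : eqType) (sg : T -> T) (s : seq T) : uniq s ->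
  {in s, forall x, sg x \in s} -> {in s, forall x, sg (sg x) = x} ->
  odd (size s) = odd (count (fun x => sg x == x) s).
Proof.
have [n] := ubnP (size s); elim: n s => // n IH [|x s] // sn us st inv.
case: (eqVneq (sg x) x) => [ex|nx].
  rewrite /= ex eqxx /=; congr (~~ _); apply: IH => //.
  - by case/andP: us.
  - move=> y ys; have := st y; rewrite !inE ys orbT => /(_ isT) /predU1P [e|//].
    have e' : y = x by rewrite -ex -e inv // inE ys orbT.
    by case/andP: us; rewrite -e' ys.
  - by move=> y ys; apply: inv; rewrite inE ys orbT.
have sxs : sg x \in s.
  by have := st x (mem_head _ _); rewrite inE (negPf nx).
pose s' := rem (sg x) s.
have [xs us'] := andP us.
have ps : perm_eq s (sg x :: s') by exact: perm_to_rem.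
have ms y : y \in s' = (y != sg x) && (y \in s) by rewrite mem_rem_uniq // inE.
have key : odd (size s') = odd (count (fun y => sg y == y) s').
  apply: IH.
  - by rewrite size_rem //; move: sn sxs => /=; case: (s) => //= a l; lia.
  - exact: rem_uniq.
  - move=> y; rewrite !ms => /andP [ny ys].
    have := st y; rewrite !inE ys orbT => /(_ isT) /predU1P [e|syS].
      by rewrite -e inv ?inE ?ys ?orbT // eqxx in ny.
    rewrite syS andbT; apply: contraNneq xs => e.
    by rewrite -[x]inv ?mem_head // -e inv // inE ys orbT.
  - by move=> y; rewrite ms => /andP [_ ys]; apply: inv; rewrite inE ys orbT.
rewrite /= (negPf nx) add0n (perm_size ps) (permP ps) /= inv ?mem_head //.
by rewrite [x == _]eq_sym (negPf nx) add0n negbK.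
Qed.

(** * Fibres of a function with divisor n (P) - n (0) *)

Section Fiber.
Variables (k : closedFieldType) (E : ellcurve k) (K : funmodel E).
Local Notation W := (weq E).
Local Notation el := (regfun K).
Local Notation fcst := (cstfun K).
Variables (P : point E) (n : nat) (f : K).
Hypotheses (P0 : P <> 0) (PP : - P <> P) (n0 : (0 < n)%N).
Hypothesis hf : hdiv f (fun R => n%:Z * dirac P R - n%:Z * dirac (pt0 E) R).
Implicit Types (R Q T z : point E) (s : seq (point E)).

Lemma fiber_ord R : R <> 0 -> R <> P -> hord R f 0.
Proof. by move=> R0 RP; have := hf R; rewrite !dirac_neq // !mulr0 subr0. Qed.

Lemma fiber_ordP : hord P f n.
Proof. by have := hf P; rewrite (dirac_eq (erefl _)) (dirac_neq P0) mulr1 mulr0 subr0. Qed.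

Lemma fiber_ord0 : hord (pt0 E) f (- n%:Z).
Proof.
have := hf (pt0 E).
by rewrite (dirac_eq (erefl _)) (dirac_neq (nesym P0)) mulr1 mulr0 sub0r.
Qed.

Lemma fiber_val0 : hasv P f 0.
Proof. by apply: hord_pos fiber_ordP. Qed.

Lemma fiber_regfun : exists A B, f = el A B.
Proof.
apply: regular_regfun => R R0; case: (eqVneq R P) => [->|/eqP RP].
  by exists 0; exact: fiber_val0.
by have [c _ h] := hord0_value (fiber_ord R0 RP); exists c.
Qed.

Lemma fiber_val R : R <> 0 -> exists c, hasv R f c.
Proof. by have [A [B ->]] := fiber_regfun; move=> R0; eexists; exact: hasv_regfun. Qed.

Lemma fiber_valP R c : R <> 0 -> hasv R f c -> c = 0 -> R = P.
Proof.
move=> R0 h c0; case: (eqVneq R P) => // /eqP RP.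
have [d nd h'] := hord0_value (fiber_ord R0 RP).
by move: nd; rewrite -(hasv_uniq h h') c0 eqxx.
Qed.

Lemma fiber_reflection : exists2 kp, kp != 0 & forall z c, z <> 0 -> z <> P ->
  hasv z f c -> hasv (P - z) f (kp / c).
Proof.
have [A [B eF]] := fiber_regfun.
have [|kp nk h] := @reflection_product _ _ P A B P0 PP.
  by move=> R R0; apply: (@fiber_valP R _ R0); rewrite eF; exact: hasv_regfun.
exists kp => // z c z0 zP hc; have hz := hasv_regfun K A B z0.
have w0 : P - z <> 0 by move/eqP; rewrite subr_eq0 eq_sym => /eqP.
have nc : c != 0 by apply/eqP => c0; apply: zP; exact: fiber_valP hc c0.
have -> : kp / c = evreg (P - z) A B.
  have ec : c = evreg z A B by apply: hasv_uniq hc _; rewrite eF.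
  by rewrite -(h z z0 zP) -ec mulrC mulKf.
by rewrite eF; apply: hasv_regfun.
Qed.

Lemma fiber_zeros r : exists s, [/\ size s = n,
  forall R, R \in s <-> R <> 0 /\ hasv R f r
  & forall R, R <> 0 -> hord R (f - fcst r) (count_mem R s)].
Proof.
have hI : hord (pt0 E) (f - fcst r) (- n%:Z).
  case: (eqVneq r 0) => [->|nr]; first by rewrite rmorph0 subr0; exact: fiber_ord0.
  apply: hordD fiber_ord0 _ _; first by apply: hordN; exact: hord_cst.
  by lia.
have [A [B eF]] := fiber_regfun.
have eS : f - fcst r = el (A - r%:P) B by rewrite eF -[B in RHS]subr0 -regfunB -fpoly_regfun.
have nz := hord_neq0 hI; rewrite eS in nz hI.
have [s [s0 sR sI]] := zeros_exist nz.
exists s; rewrite eS; split=> //; first by have := hord_uniq hI sI; lia.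
move=> R; split=> [Rs|[R0 hr]].
  split; first exact: s0; have R0 := s0 _ Rs; have h := sR R R0.
  have hp : hasv R (el (A - r%:P) B) 0.
    by apply: hord_pos h; move: Rs; rewrite -has_pred1 has_count.
  rewrite -eS in hp; have := hasvD hp (hasvC K R r).
  by rewrite add0r subrK.
apply/negPn/negP => /count_memPn c0; have := sR R R0; rewrite c0 => /hord0_value [c nc hc].
have := hasvB hr (hasvC K R r); rewrite eS subrr => hc'.
by move: nc; rewrite (hasv_uniq hc hc') eqxx.
Qed.

(** The n points of the fibre over r, counted with multiplicity, are permuted by
    z -> P - z.  When all of them except possibly Q are simple, the parity of n is
    decided by the multiplicity of Q and by the number of fixed points. *)
Lemma fiber_parity r s Q (L : seq (point E)) : r != 0 ->
  (forall R, R <> 0 -> R <> P -> hasv R f r -> hasv (P - R) f r) ->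
  size s = n -> (forall R, R \in s <-> R <> 0 /\ hasv R f r) ->
  (forall R, R \in s -> R <> Q -> count_mem R s = 1%N) ->
  uniq L -> {subset L <= s} -> (forall R, (P - R == R) = (R \in L)) ->
  odd n = odd (count_mem Q s) (+) (Q \in s) (+) odd (size L).
Proof.
move=> nr refl sn sP s1 uL Ls LP.
pose t := if Q \in s then Q :: filter (predC1 Q) s else filter (predC1 Q) s.
have mt x : (x \in t) = (x \in s).
  rewrite /t; case: ifP => [Qs|/negbT Qs]; rewrite ?inE mem_filter /=.
    by case: (eqVneq x Q) => [-> |].
  by case: (eqVneq x Q) => [-> |]; rewrite ?(negPf Qs).
have ut : uniq t.
  have uf : uniq (filter (predC1 Q) s).
    apply: count_mem_uniq => x; rewrite count_filter mem_filter /=.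
    case: (eqVneq x Q) => [->|/eqP nx] /=.
      by apply/eqP; rewrite -leqn0 leqNgt -has_count -all_predC; apply/allP => y _ /=; case: eqP.
    have -> : count (predI (pred1 x) (predC1 Q)) s = count_mem x s.
      by apply: eq_count => y /=; case: eqP => // ->; apply/eqP.
    by case: (boolP (x \in s)) => [xs|/count_memPn ->] //; rewrite s1.
  by rewrite /t; case: ifP => //= _; rewrite mem_filter /= eqxx uf.
have o1 : odd (size t) = odd n (+) odd (count_mem Q s) (+) (Q \in s).
  have <- : (count_mem Q s + count (predC1 Q) s)%N = n by rewrite -sn -(count_predC (pred1 Q)).
  rewrite /t; case: ifP => Qs /=; rewrite size_filter oddD.
    by case: (odd _); case: (odd _).
  by case: (odd _); case: (odd _).
have o2 : odd (size t) = odd (size L).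
  rewrite (@odd_size_fixed_points _ (fun R => P - R) t) //.
  - congr (odd _); rewrite -size_filter; apply/perm_size/uniq_perm => //.
      exact: filter_uniq.
    move=> R; rewrite mem_filter LP mt; case: (boolP (R \in L)) => [/Ls ->|] //.
  - move=> R; rewrite !mt => /sP [R0 hR].
    have RP : R <> P.
      by move=> e; rewrite e in hR; move: nr; rewrite (hasv_uniq hR fiber_val0) eqxx.
    apply/sP; split; first by move/eqP; rewrite subr_eq0 eq_sym => /eqP.
    exact: refl.
  - by move=> R _; rewrite opprB addrC subrK.
rewrite -o2 o1; by case: (odd _); case: (odd _); case: (_ \in _).
Qed.

End Fiber.

Section Ramification.
Variables (k : fieldType) (W : weierstrass k) (K : funmodel W).
Implicit Types (f : K) (R : point W).

(** [ram_index] in a model of the function field. *)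
Definition ramidx f R (e : nat) :=
  (exists2 c, hasv R f c & hord R (f - cstfun K c) e) \/ (hasv R f^-1 0 /\ hord R f^-1 e).
Definition is_ramified f R := exists2 e, (1 < e)%N & ramidx f R e.
End Ramification.

(** * The ordinary case *)

Section Ordinary.
Variables (k : closedFieldType) (E : ellcurve k) (K : funmodel E).
Hypothesis char2 : 2%:R = 0 :> k.
Implicit Types (P Q R T z : point E).
Local Notation px R := (loc_val R).1.
Local Notation py R := (loc_val R).2.

Lemma dWy_char2 R : dWy R = a1 E * px R + a3 E.
Proof. by rewrite /dWy char2 mul0r add0r. Qed.

Lemma two_torsionE R : R <> 0 -> (R + R == 0) = (a1 E * px R + a3 E == 0).
Proof. by move=> R0; rewrite -dWy_char2 dWy_opp // addr_eq0 eq_sym. Qed.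

Lemma addr_char2 (x : k) : x + x = 0.
Proof. by rewrite -mulr2n -mulr_natr char2 mulr0. Qed.

(** In characteristic 2 a point has order 2 when a1 x + a3 = 0, and there is one
    point with this abscissa since it equals its opposite. *)
Lemma two_torsion_ordinary : a1 E != 0 -> exists2 T, T <> 0 &
  forall R, (R + R == 0) = (R == 0) || (R == T).
Proof.
move=> na; have [T [T0 Tx]] := point_above E (a3 E / a1 E).
have TT : T + T == 0.
  by rewrite two_torsionE // Tx mulrCA divff // mulr1 addr_char2.
exists T => // R; case: (eqVneq R 0) => [->|/eqP R0]; first by rewrite addr0 eqxx.
apply/idP/eqP => [RR|-> //]; have := RR; rewrite two_torsionE // => /eqP e.
have ex : px R = px T.
  rewrite Tx; apply: (mulfI na); rewrite mulrCA divff // mulr1.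
  apply/eqP; rewrite -subr_eq0; apply/eqP.
  by rewrite -e -[in RHS](subr0 (_ + _)) -(addr_char2 (a3 E)); ring.
have [-> //|->] := same_x_opp R0 T0 ex.
by rewrite opp_ptE; apply/eqP; rewrite -addr_eq0.
Qed.

Lemma two_torsion_ss R : a1 E = 0 -> R + R = 0 -> R = 0.
Proof.
move=> a0 /eqP RR; case: (eqVneq R 0) => // /eqP R0.
move: RR; rewrite two_torsionE // a0 mul0r add0r => /eqP a30.
have := weq_smooth E; rewrite /discriminant /b2 /b4 /b6 /b8 a0 a30.
have -> : 4%:R = 2%:R * 2%:R :> k by ring.
have -> : 8%:R = 2%:R * 4%:R :> k by ring.
by rewrite char2 !(mul0r, expr0n, mulr0, addr0, subr0, oppr0) eqxx.
Qed.

Lemma odd_torsion_two_torsion P n : odd n -> P *+ n = 0 -> P + P = 0 -> P = 0.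
Proof.
move=> on; have -> : n = (2 * n./2).+1 by rewrite mul2n -[LHS]odd_double_half on.
by rewrite mulrS mulrnA mulr2n => h PP; move: h; rewrite PP mul0rn addr0.
Qed.

Lemma half_point P n : odd n -> P *+ n = 0 -> (P *+ n.+1./2) + (P *+ n.+1./2) = P.
Proof.
move=> on e; rewrite -mulrnDr addnn.
have -> : n.+1./2.*2 = n.+1 by rewrite -[RHS]odd_double_half /= on.
by rewrite mulrS e addr0.
Qed.

(** At a fixed point z of the reflection the product of [fiber_reflection] is
    f(z)^2; in characteristic 2 the square root is unique, so all the fixed points
    lie in the same fibre, and this fibre is stable under the reflection. *)
Lemma fiber_over_half f (P Q : point E) n : P <> 0 -> - P <> P -> (0 < n)%N ->
  hdiv f (fun R => n%:Z * dirac P R - n%:Z * dirac (pt0 E) R) -> Q + Q = P ->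
  exists2 r, r != 0 & hasv (K := K) Q f r /\
    (forall R, R <> 0 -> R <> P -> hasv R f r -> hasv (P - R) f r) /\
    (forall R, R <> 0 -> R + R = P -> hasv R f r).
Proof.
move=> P0 PP n0 hf QQ.
have Q0 : Q <> 0 by move=> e; apply: P0; rewrite -QQ e addr0.
have hP R : R <> 0 -> R + R = P -> R <> P.
  by move=> R0 e RP; apply: R0; apply: (addrI R); rewrite addr0 e.
have [kp nk refl] := fiber_reflection P0 PP n0 hf.
have [r hr] := fiber_val P0 n0 hf Q0.
have nr : r != 0.
  by apply/eqP => r0; apply: (hP Q Q0 QQ); exact: (fiber_valP hf Q0 hr r0).
have sq R c : R <> 0 -> R + R = P -> hasv R f c -> c ^+ 2 = kp.
  move=> R0 RR hc; have h := refl R c R0 (hP R R0 RR) hc.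
  rewrite -RR addrK in h; have nc : c != 0.
    by apply/eqP => c0; apply: (hP R R0 RR); exact: (fiber_valP hf R0 hc c0).
  by rewrite expr2 {2}(hasv_uniq hc h) mulrC divfK.
exists r => //; split=> //; split=> [R R0 RP hR|R R0 RR].
  have := refl R r R0 RP hR; rewrite -(sq Q r Q0 QQ hr) expr2 mulfK //.
have [c hc] := fiber_val P0 n0 hf R0; suff <- : c = r by [].
apply/eqP; rewrite -subr_eq0; suff : (c - r) ^+ 2 == 0 by rewrite expf_eq0.
have -> : (c - r) ^+ 2 = c ^+ 2 + r ^+ 2 - (c * r + c * r) by ring.
by rewrite (sq R c R0 RR hc) (sq Q r Q0 QQ hr) !addr_char2 subr0.
Qed.

(** When a1 <> 0 the reflection has two fixed points, the halves Q1 and Q1 + T of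
    P.  In their common fibre all points are simple except possibly Q, which has
    multiplicity 3; both cases make n even. *)
Lemma no_lame_ordinary f (P Q : point E) n : a1 E != 0 -> odd n -> P <> 0 -> P *+ n = 0 ->
  hdiv (K := K) f (fun R => n%:Z * dirac P R - n%:Z * dirac (pt0 E) R) ->
  (forall R, is_ramified f R -> [\/ R = 0, R = P | R = Q]) -> ramidx f Q 3 -> False.
Proof.
move=> na on P0 Pn hf ram ramQ.
have n0 : (0 < n)%N by case: (n) on.
have PP : - P <> P.
  by move=> e; apply: P0; apply: (odd_torsion_two_torsion on Pn); rewrite -{1}e addNr.
have [T T0 tor] := two_torsion_ordinary na.
pose Q1 := P *+ n.+1./2; have Q1P : Q1 + Q1 = P by apply: half_point.
have TT : T + T = 0 by apply/eqP; rewrite tor eqxx orbT.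
have hN R : R + R = P -> R <> 0 by move=> e R0; apply: P0; rewrite -e R0 addr0.
have [r nr [hQ1 [refl half]]] := fiber_over_half P0 PP n0 hf Q1P.
have [s [sn sP sR]] := fiber_zeros P0 n0 hf r.
have Q2P : (Q1 + T) + (Q1 + T) = P by rewrite addrACA Q1P TT addr0.
have := @fiber_parity _ _ _ P n f P0 n0 hf r s Q [:: Q1; Q1 + T] nr refl sn sP.
rewrite on /= => par.
have {par} : true = odd (count_mem Q s) (+) (Q \in s) (+) false.
  apply: par.
  - move=> R /[dup] Rs /sP [R0 hR] RQ; have h := sR R R0.
    have c1 : (0 < count_mem R s)%N by rewrite -has_count has_pred1.
    apply/eqP; rewrite eqn_leq c1 andbT leqNgt; apply/negP => c2.
    have [] : [\/ R = 0, R = P | R = Q] by apply: ram; exists (count_mem R s) => //; left; exists r.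
    + by [].
    + by move=> e; rewrite e in hR; move: nr; rewrite (hasv_uniq hR (fiber_val0 P0 n0 hf)) eqxx.
    + by [].
  - rewrite inE andbT eq_sym -subr_eq0 addrC addKr; exact/eqP.
  - move=> R; rewrite !inE => /orP [] /eqP ->; apply/sP; split; try exact: hN.
      by apply: half => //; exact: hN.
    by apply: half => //; exact: hN.
  - move=> R; rewrite !inE.
    have -> : (P - R == R) = ((R - Q1) + (R - Q1) == 0).
      by rewrite addrACA -opprD Q1P subr_eq0 subr_eq eq_sym.
    by rewrite tor subr_eq0 subr_eq [T + _]addrC.
rewrite addbF; case: (boolP (Q \in s)) => [/sP [Q0 hQ]|/count_memPn -> //].
suff -> : count_mem Q s = 3%N by [].
have h := sR Q Q0; case: ramQ => [[c hc h3]|[h3 _]].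
  by rewrite (hasv_uniq hc hQ) in h3; have := hord_uniq h h3; lia.
have := hasv_uniq (hasvV nr hQ) h3 => /eqP; by rewrite invr_eq0 (negPf nr).
Qed.

End Ordinary.

(** * The supersingular case *)

Section RamIndexUnique.
Variables (k : fieldType) (E : ellcurve k) (K : funmodel E).

Lemma ramidx_uniq (f : K) (R : point E) e e' : ramidx f R e -> ramidx f R e' -> e = e'.
Proof.
have mixed c : hasv R f c -> hasv R f^-1 0 -> f = 0.
  move=> hc h0; apply/eqP; apply: contraTT (oner_neq0 k) => nf.
  rewrite negbK -(mulr0 c); apply/eqP; apply: hasv_uniq (hasv1 K R) _.
  by rewrite -(divff nf); apply: hasvM.
case=> [[c hc h]|[h0 h]] [[c' hc' h']|[h0' h']].
- by rewrite (hasv_uniq hc' hc) in h'; have := hord_uniq h h'; lia.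
- by have := hord_neq0 h'; rewrite invr_eq0 (mixed _ hc h0') eqxx.
- by have := hord_neq0 h; rewrite invr_eq0 (mixed _ hc' h0) eqxx.
- by have := hord_uniq h h'; lia.
Qed.
End RamIndexUnique.

Section Char2Local.
Variables (k : fieldType) (E : ellcurve k) (K : funmodel E).
Hypothesis char2 : 2%:R = 0 :> k.
Local Notation fcst := (cstfun K).

Lemma ff_char2 : 2%:R = 0 :> K.
Proof. by rewrite -(rmorph_nat fcst) char2 rmorph0. Qed.

Lemma ff_opp (g : K) : - g = g.
Proof. by apply/eqP; rewrite -subr_eq0 -opprD oppr_eq0 -mulr2n -mulr_natr ff_char2 mulr0. Qed.

(** In characteristic 2 the factor psi^2 differs from its value c^2 by
    (psi - c)^2, which has order at least 2 and does not affect simple zeros. *)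
Lemma unramified_sqrM R (psi M : K) c d : c != 0 -> hasv R psi c -> hasv R M d ->
  hord R (M - fcst d) 1 -> hord R (psi ^+ 2 * M - fcst (c ^+ 2 * d)) 1.
Proof.
move=> nc hpsi hM hMd; have [t ut] := unif_exists K R.
have [v [v0 [hv nv eM]]] := hord_with ut hMd; rewrite expr1z in eM.
have [h [h0 [hh eh]]] : exists h h0, hasv R h h0 /\ psi - fcst c = t * h.
  by apply: ut.2; rewrite -(subrr c); apply: hasvB hpsi (hasvC _ _ _).
have hu : hasv R (psi ^+ 2 * v + t * (h ^+ 2 * fcst d)) (c ^+ 2 * v0 + 0 * (h0 ^+ 2 * d)).
  apply: hasvD; first by apply: hasvM => //; apply: hasvX.
  by apply: hasvM ut.1 _; apply: hasvM (hasvC _ _ _); apply: hasvX.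
apply: (hordI ut hu); first by rewrite mul0r addr0 mulf_neq0 ?expf_neq0.
rewrite expr1z mulrDr; have -> : t * (psi ^+ 2 * v) = psi ^+ 2 * (M - fcst d) by rewrite eM; ring.
have -> : t * (t * (h ^+ 2 * fcst d)) = (psi - fcst c) ^+ 2 * fcst d by rewrite eh; ring.
have -> : (psi - fcst c) ^+ 2 = psi ^+ 2 - fcst c ^+ 2.
  have -> : (psi - fcst c) ^+ 2 =
    psi ^+ 2 - fcst c ^+ 2 - 2%:R * (psi * fcst c - fcst c ^+ 2) by ring.
  by rewrite ff_char2 mul0r subr0.
by rewrite rmorphM rmorphXn; ring.
Qed.

(** The order of the sum is the smaller of 3 and the order of Psi^2, which is
    even. *)
Lemma odd_ord_sqr_cube R (t Psi w : K) d (e : nat) : unif R t -> hasv R Psi 0 ->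
  hasv R w d -> d != 0 -> odd e -> hord R (Psi ^+ 2 + t ^+ 3 * w) e -> e = 3%N.
Proof.
move=> ut hPsi hw nd oe he.
have [v [v0 [hv eP]]] := ut.2 _ hPsi.
have hord_t g c (n : nat) : hasv R g c -> c != 0 -> hord R (t ^+ n * g) n.
  by move=> hg ng; apply: (hordI ut hg ng).
case: (eqVneq v0 0) => [v00|nv].
  rewrite v00 in hv; have [v' [v0' [hv' eV]]] := ut.2 _ hv.
  have h3 : hord R (t ^+ 3 * (t * v' ^+ 2 + w)) 3.
    apply: (hord_t _ (0 * v0' ^+ 2 + d)); last by rewrite mul0r add0r.
    by apply: hasvD => //; apply: hasvM ut.1 _; apply: hasvX.
  have eg : Psi ^+ 2 + t ^+ 3 * w = t ^+ 3 * (t * v' ^+ 2 + w) by rewrite eP eV; ring.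
  by rewrite eg in he; have := hord_uniq he h3; lia.
have h2 : hord R (t ^+ 2 * (v ^+ 2 + t * w)) 2.
  apply: (hord_t _ (v0 ^+ 2 + 0 * d)); last by rewrite mul0r addr0 expf_neq0.
  by apply: hasvD; [apply: hasvX | apply: hasvM ut.1 _].
have eg : Psi ^+ 2 + t ^+ 3 * w = t ^+ 2 * (v ^+ 2 + t * w) by rewrite eP; ring.
by rewrite eg in he; have := hord_uniq he h2 => e2; move: oe; have -> : e = 2%N by lia.
Qed.
End Char2Local.

(** Here a1 = 0 and n = 2 m + 1, so that Q = (m + 1) P satisfies 2 Q = P and
    - Q = m P.  The function with divisor n (P) - n (0) is f = phi^2 L, where phi has
    divisor m (P) - (- Q) - (m - 1) (0) and L = 0 is the tangent at - Q, whose third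
    intersection is P. *)
Section Supersingular.
Variables (k : closedFieldType) (E : ellcurve k) (K : funmodel E).
Hypothesis char2 : 2%:R = 0 :> k.
Hypothesis a10 : a1 E = 0.
Local Notation W := (weq E).
Local Notation fcst := (cstfun K).
Local Notation fpoly := (fpol K).
Local Notation el := (regfun K).
Local Notation gx := (xfun K).
Local Notation yfun := (yfun K).
Local Notation px R := (loc_val R).1.
Local Notation py R := (loc_val R).2.

Variables (P : point E) (n : nat).
Hypotheses (P0 : P <> 0) (on : odd n) (Pn : P *+ n = 0).

Let m := n./2.
Let Q := P *+ m.+1.

Lemma odd_split : n = (m + m).+1.
Proof. by rewrite addnn -[LHS]odd_double_half on. Qed.
Lemma double_half : Q + Q = P.
Proof. by rewrite -mulrnDr addSn addnS -odd_split mulrS Pn addr0. Qed.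
Lemma opp_half : - Q = P *+ m.
Proof.
apply/eqP; rewrite eq_sym -addr_eq0 -mulrnDr; apply/eqP.
by rewrite addnS -odd_split.
Qed.
Lemma half_neq0 : Q <> 0. Proof. by move=> e; apply: P0; rewrite -double_half e addr0. Qed.
Lemma opp_half_neq0 : - Q <> 0. Proof. by move/eqP; rewrite oppr_eq0 => /eqP; exact: half_neq0. Qed.
Lemma half_neq_opp : - Q <> - - Q.
Proof.
rewrite opprK => /eqP; rewrite eq_sym -addr_eq0 => /eqP /(two_torsion_ss char2 a10).
exact: half_neq0.
Qed.
Lemma half_neq : Q <> P.
Proof. by move=> e; apply: half_neq0; apply: (addrI Q); rewrite addr0 double_half. Qed.
Lemma point_neq_opp : - P <> P.
Proof.
move/eqP; rewrite eq_sym -addr_eq0 => /eqP /(two_torsion_ss char2 a10); exact: P0.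
Qed.

Lemma a3_neq0 : a3 E != 0.
Proof.
have := weq_smooth E; apply: contraNneq => a30; rewrite /discriminant /b2 /b4 /b6 /b8 a10 a30.
have -> : 4%:R = 2%:R * 2%:R :> k by ring.
have -> : 8%:R = 2%:R * 4%:R :> k by ring.
by rewrite char2 !(mul0r, expr0n, mulr0, addr0, subr0, oppr0).
Qed.

Lemma dWy_ss (R : point E) : dWy R = a3 E.
Proof. by rewrite dWy_char2 // a10 mul0r add0r. Qed.
Lemma three1 : 3%:R = 1 :> k.
Proof. by rewrite -addn1 natrD char2 add0r. Qed.
Lemma dWx_ss (R : point E) : dWx R = px R ^+ 2 + a4 E.
Proof. by rewrite /dWx a10 mul0r subr0 char2 !mul0r addr0 three1 mul1r. Qed.

(** The slope of the tangent is (x^2 + a4) / a3 and depends only on x, so l is the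
    slope both at Q and at - Q, and no other affine point has this slope. *)
Let l := (px Q ^+ 2 + a4 E) / a3 E.
Let mu := py (- Q) - l * px Q.
Let L : K := el (line l mu) 1.
Let x_opp_half : px (- Q) = px Q. Proof. by rewrite -opp_ptE loc_val_opp //; exact: half_neq0. Qed.

Lemma slopeE : chord_slope W (px (- Q)) (py (- Q)) (px (- Q)) (py (- Q)) = l.
Proof.
rewrite /chord_slope eqxx; have := dWx_ss (- Q); have := dWy_ss (- Q).
by rewrite /dWx /dWy => -> ->; rewrite x_opp_half.
Qed.

Lemma tangent_fun : L = yfun - fcst l * gx - fcst mu.
Proof.
rewrite /L /regfun /line rmorph1 mul1r rmorphN rmorphD -mul_polyC rmorphM.
by rewrite /cstfun /xfun; ring.
Qed.

Lemma hdiv_tangent : hdiv L (fun R => 2 * dirac (- Q) R + dirac P R - 3 * dirac (pt0 E) R).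
Proof.
have [_] := hdiv_line K opp_half_neq0 opp_half_neq0 half_neq_opp; rewrite slopeE x_opp_half.
apply: hdiv_ext => R; rewrite opp_ptE add_ptE -opprD double_half opprK; ring.
Qed.

Let t := locx K Q.

(** The norm of L: its conjugate is L + a3, and the roots of the norm are x(Q),
    twice, and x(P). *)
Lemma tangent_fun_conj : fcst (a3 E) * L = L ^+ 2 + t ^+ 2 * locx K P.
Proof.
have [eB eQ] := chord_quadratic opp_half_neq0 opp_half_neq0 half_neq_opp; rewrite slopeE in eQ.
have eC := add_coordsE opp_half_neq0 opp_half_neq0 half_neq_opp; rewrite slopeE in eC.
have mE : py (- Q) = l * px (- Q) + mu by rewrite x_opp_half /mu; ring.
have := xnorm_line opp_half_neq0 mE eQ.
have <- : px P = l ^+ 2 + a1 W * l - a2 W - px (- Q) - px (- Q).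
  have -> : P = - (- Q + - Q) by rewrite -opprD double_half opprK.
  rewrite -opp_ptE loc_val_opp; last by rewrite -opprD double_half; move/eqP; rewrite oppr_eq0 => /eqP.
  by rewrite /loc_val -add_ptE eC.
move/(congr1 fpoly); rewrite -regfun_xnorm !big_cons big_nil mulr1 x_opp_half scaleN1r rmorphN !rmorphM.
rewrite -!locxE -/t -/L ff_opp // => e.
have -> : t ^+ 2 * locx K P = t * (t * locx K P) by ring.
rewrite -e; have -> : el (line l mu - 1 * weq_lin W) (- 1) = L + fcst (a3 E).
  rewrite mul1r /weq_lin a10 scale0r add0r /L /regfun rmorphB -/(fcst (a3 E)) rmorphN1 rmorph1.
  transitivity (fpoly (line l mu) - fcst (a3 E) + - 1 * yfun + 2%:R * (fcst (a3 E) + yfun)).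
    by rewrite ff_char2 // mul0r addr0.
  by ring.
have -> : L ^+ 2 + L * (L + fcst (a3 E)) = fcst (a3 E) * L + 2%:R * L ^+ 2 by ring.
by rewrite ff_char2 // mul0r addr0.
Qed.

Lemma root_function : exists phi : K,
  hdiv phi (fun R => m%:Z * dirac P R - dirac (- Q) R - (m%:Z - 1) * dirac (pt0 E) R).
Proof. by have := principal_mul K P m; rewrite opp_half. Qed.

(** L minus its value at R is a line through R, with a simple zero there unless it
    is the tangent. *)
Lemma hord_tangent R : R <> 0 -> R <> Q -> R <> - Q -> exists d, hasv R L d /\
  hord R (L - fcst d) 1.
Proof.
move=> R0 RQ RoQ; exists (py R - l * px R - mu); split.
  rewrite tangent_fun; apply: hasvB (hasvC _ _ _); apply: hasvB (hasv_yfun _ R0) _.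
  exact: hasvM (hasvC _ _ _) (hasv_xfun _ R0).
have nS : dWy R != 0 by rewrite dWy_ss a3_neq0.
have hS := hasv_locS K R0; have nS' := hasv_neq0 nS hS.
have -> : L - fcst (py R - l * px R - mu) = locx K R * (locG K R / locS K R - fcst l).
  rewrite mulrBr mulrA -locy_locS // mulfK // tangent_fun /locx /locy.
  have fE (a b c d : k) : fcst (a - b * c - d) = fcst a - fcst b * fcst c - fcst d.
    by rewrite !rmorphB rmorphM.
  by rewrite fE; ring.
have hv : hasv R (locG K R / locS K R - fcst l) (dWx R / dWy R - l).
  by apply: hasvB (hasvC _ _ _); apply: hasvM (hasv_locG _ R0) (hasvV nS hS).
have nv : dWx R / dWy R - l != 0.
  rewrite dWx_ss dWy_ss /l -mulrBl mulf_neq0 ?invr_neq0 ?a3_neq0 //.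
  have -> : px R ^+ 2 + a4 E - (px Q ^+ 2 + a4 E) =
    (px R - px Q) ^+ 2 + 2%:R * (px R * px Q - px Q ^+ 2) by ring.
  rewrite char2 mul0r addr0 expf_neq0 // subr_eq0; apply/eqP => ex.
  by have [] := same_x_opp half_neq0 R0 (esym ex).
exact: hord_mulu nv hv (hord_locx1 K R0 nS).
Qed.

Variable phi : K.
Hypothesis hphi :
  hdiv phi (fun R => m%:Z * dirac P R - dirac (- Q) R - (m%:Z - 1) * dirac (pt0 E) R).
Let f := phi ^+ 2 * L.

Lemma hdiv_lame : hdiv f (fun R => n%:Z * dirac P R - n%:Z * dirac (pt0 E) R).
Proof.
apply: hdiv_ext (hdivM (hdivX 2 hphi) hdiv_tangent) => R.
have -> : n%:Z = m%:Z + m%:Z + 1 by rewrite {1}odd_split -[_.+1]addn1 !PoszD.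
by rewrite mulr2n; ring.
Qed.

Lemma unramified_generic R : R <> 0 -> R <> P -> R <> Q -> R <> - Q ->
  exists2 c, hasv R f c & hord R (f - fcst c) 1.
Proof.
move=> R0 RP RQ RoQ; have [d [hd hL]] := hord_tangent R0 RQ RoQ.
have [c nc hc] : exists2 c, c != 0 & hasv R phi c.
  by apply: hord0_value; have := hphi R; rewrite !dirac_neq // !mulr0 !subr0.
exists (c ^+ 2 * d); first by apply: hasvM hd; apply: hasvX.
exact: unramified_sqrM.
Qed.

Lemma hord_x_half R : R <> 0 -> px R = px Q -> hord R t 1.
Proof.
move=> R0 ex; rewrite /t; have -> : locx K Q = locx K R by rewrite /locx ex.
by apply: hord_locx1 => //; rewrite dWy_ss a3_neq0.
Qed.

(** At - Q the factors phi and L have a simple pole and a double zero.  They are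
    replaced by the units phi t and M = L / t^2, and [tangent_fun_conj] becomes
    a3 M = t^2 M^2 + x - x(P), which shows that M minus its value has order 1. *)
Lemma unramified_opp_half : - Q <> P ->
  exists2 c, hasv (- Q) f c & hord (- Q) (f - fcst c) 1.
Proof.
move=> oQP'; have ht := hord_x_half opp_half_neq0 x_opp_half; have nt := hord_neq0 ht.
have [c nc hc] : exists2 c, c != 0 & hasv (- Q) (phi * t) c.
  apply: hord0_value; apply: hord_eq (hordM (hphi (- Q)) ht).
  by rewrite (dirac_neq oQP') (dirac_eq (erefl _)) (dirac_neq opp_half_neq0); lia.
pose M := L / t ^+ 2.
have [d nd hd] : exists2 d, d != 0 & hasv (- Q) M d.
  apply: hord0_value; apply: hord_eq (hordM (hdiv_tangent (- Q)) (hordV (hordX 2 ht))).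
  by rewrite (dirac_neq oQP') (dirac_eq (erefl _)) (dirac_neq opp_half_neq0) mulr2n; lia.
have fE : f = (phi * t) ^+ 2 * M.
  transitivity (phi ^+ 2 * (M * t ^+ 2)); last by ring.
  by rewrite /M divfK // expf_neq0.
have a3M : fcst (a3 E) * M = t ^+ 2 * M ^+ 2 + locx K P.
  have nt2 : t ^+ 2 != 0 by rewrite expf_neq0.
  by apply: (mulIf nt2); rewrite /M mulrA divfK // tangent_fun_conj mulrDl exprMn exprVn; congr (_ + _);
    [rewrite mulrAC -mulrA; field | rewrite mulrC].
rewrite fE; exists (c ^+ 2 * d); first by apply: hasvM hd; apply: hasvX.
apply: unramified_sqrM => //.
have vt : hasv (- Q) t 0 by apply: hord_pos ht.
have ed : a3 E * d = px Q - px P.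
  apply: hasv_uniq (hasvM (hasvC K (- Q) (a3 E)) hd) _; rewrite a3M.
  apply: (@hasv_val _ _ _ _ _ (0 ^+ 2 * d ^+ 2 + (px (- Q) - px P))).
    by rewrite expr0n mul0r add0r x_opp_half.
  apply: hasvD; first by apply: hasvM; apply: hasvX.
  exact: hasvB (hasv_xfun _ opp_half_neq0) (hasvC _ _ _).
have -> : M - fcst d = t * (1 + t * M ^+ 2) / fcst (a3 E).
  apply: (canRL (mulfK _)); first by rewrite fmorph_eq0 a3_neq0.
  rewrite mulrBl [M * _]mulrC a3M -rmorphM [d * _]mulrC ed rmorphB.
  by rewrite /t /locx; ring.
apply: hord_divu a3_neq0 (hasvC _ _ _) _.
have n1 : (1 : k) + 0 * d ^+ 2 != 0 by rewrite mul0r addr0 oner_eq0.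
apply: (hord_mulu n1 _ ht); apply: hasvD (hasv1 _ _) _.
by apply: hasvM => //; apply: hasvX.
Qed.

Lemma tangent_value_half : hasv Q L (a3 E).
Proof.
apply: (@hasv_val _ _ _ _ _ (py Q - l * px Q - mu)).
  rewrite /mu -opp_ptE (loc_val_opp half_neq0) /= a10 mul0r subr0.
  have -> : py Q - l * px Q - (- py Q - a3 E - l * px Q) = a3 E + 2%:R * py Q by ring.
  by rewrite char2 mul0r addr0.
rewrite tangent_fun; apply: hasvB (hasvC _ _ _); apply: hasvB (hasv_yfun _ half_neq0) _.
exact: hasvM (hasvC _ _ _) (hasv_xfun _ half_neq0).
Qed.

Lemma root_value_half : exists2 c, c != 0 & hasv Q phi c.
Proof.
apply: hord0_value; have := hphi Q; rewrite (dirac_neq half_neq) (dirac_neq half_neq0) dirac_neq.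
  by rewrite !mulr0 !subr0.
by move=> e; apply: half_neq_opp; rewrite opprK.
Qed.

(** The conjugate L + a3 of L vanishes at Q.  Inserting [tangent_fun_conj] into
    a3 (f - f(Q)) gives the square of a function vanishing at Q plus t^3 phi^2, all
    cross terms being multiples of 2. *)
Lemma odd_ramification_half c e : odd e -> hasv Q f c -> hord Q (f - fcst c) e -> e = 3%N.
Proof.
move=> oe hc he; have [c0 nc0 hphi0] := root_value_half.
have ec : c = c0 ^+ 2 * a3 E.
  by apply: hasv_uniq hc _; apply: hasvM tangent_value_half; apply: hasvX.
(* de^2 = x(Q) - x(P), so that x - x(P) = t + de^2 *)
have [de ede] := closed_quadratic 0 (px Q - px P).
rewrite mul0r addr0 in ede.
pose A := fcst (a3 E); pose Lb := L + A; pose D := fcst de.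
have hLb : hasv Q Lb 0.
  by rewrite -(addr_char2 char2 (a3 E)); apply: hasvD tangent_value_half (hasvC _ _ _).
have ut : unif Q t by apply: unif_locx; [exact: half_neq0 | rewrite dWy_ss a3_neq0].
pose Psi := phi * Lb + A * (phi - fcst c0) + phi * t * D.
have hPsi : hasv Q Psi 0.
  apply: (@hasv_val _ _ _ _ _ (c0 * 0 + a3 E * (c0 - c0) + c0 * 0 * de)); first by ring.
  apply: hasvD; last by apply: hasvM (hasvC _ _ _); apply: hasvM ut.1.
  apply: hasvD; first exact: hasvM.
  by apply: hasvM (hasvC _ _ _) _; apply: hasvB (hasvC _ _ _).
have tP : locx K P = t + D ^+ 2.
  by rewrite /D -rmorphXn ede rmorphB /t /locx; ring.
have key : A * (f - fcst c) = Psi ^+ 2 + t ^+ 3 * phi ^+ 2.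
  have e1 := tangent_fun_conj; rewrite tP -/A in e1.
  rewrite ec rmorphM rmorphXn -/A /f /Psi /Lb.
  have -> : A * (phi ^+ 2 * L - fcst c0 ^+ 2 * A) =
    phi ^+ 2 * (A * L) - A ^+ 2 * fcst c0 ^+ 2 by ring.
  rewrite e1; apply/eqP; rewrite -subr_eq0.
  set x := fcst c0; apply/eqP.
  (* the difference of the two sides, collected as a multiple of 2 *)
  transitivity (2%:R * (- (phi * (L + A) * (A * (phi - x))) - phi * (L + A) * (phi * t * D)
    - A * (phi - x) * (phi * t * D) - phi ^+ 2 * (L * A) - A ^+ 2 * (phi ^+ 2 + x ^+ 2)
    + A ^+ 2 * phi * x)); first by ring.
  by rewrite ff_char2 // mul0r.
apply: (odd_ord_sqr_cube ut hPsi (hasvX 2 hphi0) _ oe).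
  by rewrite expf_neq0.
by rewrite -key mulrC; apply: hord_mulu a3_neq0 (hasvC _ _ _) he.
Qed.

(** The reflection z -> P - z now has Q as its only fixed point, and n is odd, so Q
    has odd multiplicity in its fibre. *)
Lemma ramified_half : ramidx f Q 3.
Proof.
have n0 : (0 < n)%N by case: (n) on.
have hf := hdiv_lame.
have [r nr [hr [refl half]]] := fiber_over_half char2 P0 point_neq_opp n0 hf double_half.
have [s [sn sP sR]] := fiber_zeros P0 n0 hf r.
have Qs : Q \in s by apply/sP; split=> //; exact: half_neq0.
have par : odd n = odd (count_mem Q s) (+) (Q \in s) (+) odd (size [:: Q]).
  apply: (fiber_parity P0 n0 hf nr refl sn sP) => //.
  - move=> R Rs RQ; have [R0 hR] := (sP R).1 Rs.
    have RP : R <> P.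
      by move=> e; rewrite e in hR; move: nr; rewrite (hasv_uniq hR (fiber_val0 P0 n0 hf)) eqxx.
    have [c hc h1] : exists2 c, hasv R f c & hord R (f - fcst c) 1.
      case: (eqVneq R (- Q)) => [eR|/eqP nR]; last exact: unramified_generic.
      by rewrite eR; apply: unramified_opp_half; rewrite -eR.
    by rewrite (hasv_uniq hc hR) in h1; have := hord_uniq h1 (sR R R0); lia.
  - by move=> R; rewrite inE => /eqP ->.
  - move=> R; rewrite inE; apply/eqP/eqP => [e|->]; last by rewrite -{1}double_half addrK.
    have e2 : R + R = P by rewrite -{1}e subrK.
    apply/eqP; rewrite -subr_eq0; apply/eqP; apply: (two_torsion_ss char2 a10).
    by rewrite addrACA -opprD e2 double_half subrr.
rewrite Qs on /= addbT addbT negbK in par.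
have h := sR Q half_neq0; left; exists r => //.
by rewrite -(odd_ramification_half (esym par) hr h).
Qed.

Lemma lame_function : [/\ forall R, [\/ R = 0, R = P | R = Q] \/ ramidx f R 1,
  ramidx f 0 n, ramidx f P n & ramidx f Q 3].
Proof.
have n0 : (0 < n)%N by case: (n) on.
have hf := hdiv_lame; split.
- move=> R; case: (eqVneq R 0) => [->|/eqP R0]; first by left; constructor.
  case: (eqVneq R P) => [->|/eqP RP]; first by left; constructor.
  case: (eqVneq R Q) => [->|/eqP RQ]; first by left; constructor.
  right; left; case: (eqVneq R (- Q)) => [eR|/eqP nR]; last exact: unramified_generic.
  by rewrite eR; apply: unramified_opp_half; rewrite -eR.
- have h := hordV (fiber_ord0 P0 hf); rewrite opprK in h.
  by right; split=> //; apply: hord_pos h.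
- left; exists 0; first exact: (fiber_val0 P0 n0 hf).
  by rewrite rmorph0 subr0; exact: (fiber_ordP P0 hf).
- exact: ramified_half.
Qed.

End Supersingular.

Lemma lame_function_exists (k : closedFieldType) (E : ellcurve k) (K : funmodel E)
    (P : point E) n : 2%:R = 0 :> k -> a1 E = 0 -> P <> 0 -> odd n -> P *+ n = 0 ->
  let Q := P *+ (n./2).+1 in exists f : K,
  [/\ hdiv f (fun R => n%:Z * dirac P R - n%:Z * dirac (pt0 E) R),
      forall R, [\/ R = 0, R = P | R = Q] \/ ramidx f R 1,
      ramidx f 0 n, ramidx f P n & ramidx f Q 3].
Proof.
move=> char2 a10 P0 on Pn Q; have [phi hphi] := root_function K on Pn.
eexists; have [] := lame_function char2 a10 P0 on Pn hphi; split; try eassumption.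
exact: (hdiv_lame char2 a10 P0 on Pn hphi).
Qed.

(** * Points are torsion over an algebraic extension of F_2 *)

Lemma pigeonhole (T : eqType) (S : seq T) (g : nat -> T) :
  (forall i, g i \in S) -> exists i j, (i < j)%N /\ g i = g j.
Proof.
move=> gS; pose s := map g (iota 0 (size S).+1).
have /(uniqPn (g 0%N)) [i [j [ij jS e]]] : ~~ uniq s.
  apply/negP => us; have sS : {subset s <= S} by move=> _ /mapP [i _ ->].
  by have := uniq_leq_size us sS; rewrite size_map size_iota ltnn.
move: jS; rewrite size_map size_iota => jS; exists i, j; split=> //.
move: e; rewrite !(nth_map 0%N) ?size_iota ?(ltn_trans ij) // !nth_iota // (ltn_trans ij) //.
Qed.

Section Torsion.
Variables (k : closedFieldType) (iota : {rmorphism 'F_2 -> k}).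
Hypothesis k_algebraic : integralRange iota.

Lemma pchar2 : 2%N \in [pchar k].
Proof.
apply/andP; split=> //; apply/eqP; rewrite -(rmorph_nat iota).
by rewrite pchar_Fp_0 // rmorph0.
Qed.

Lemma frobD m (x y : k) : (x + y) ^+ (2 ^ m) = x ^+ (2 ^ m) + y ^+ (2 ^ m).
Proof. by apply: exprDn_pchar; rewrite pnatX pnatE // pchar2. Qed.

Lemma frob0 m : (0 : k) ^+ (2 ^ m) = 0.
Proof. by rewrite expr0n expn_eq0. Qed.

Lemma frob_inj m : injective (fun x : k => x ^+ (2 ^ m)).
Proof.
move=> x y /= e; apply/eqP; rewrite -subr_eq0; suff : (x - y) ^+ (2 ^ m) == 0.
  by rewrite expf_eq0 => /andP [].
have := frobD m (x - y) y; rewrite subrK e => /eqP.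
by rewrite eq_sym -subr_eq0 addrK.
Qed.

(** The powers x^(2^j) are values at x of polynomials over F_2 of bounded degree,
    so two of them agree, and Frobenius is injective. *)
Lemma frob_fixed (x : k) : exists m, (0 < m)%N /\ x ^+ (2 ^ m) = x.
Proof.
have [p pm rp] := k_algebraic x.
pose q (j : nat) : {poly 'F_2} := Pdiv.Ring.rmodp ('X ^+ (2 ^ j)) p.
have qx j : (map_poly iota (q j)).[x] = x ^+ (2 ^ j).
  have := Pdiv.RingMonic.rdivp_eq pm ('X ^+ (2 ^ j)).
  move/(congr1 (map_poly iota)); rewrite rmorphD rmorphM /= map_polyXn => /(congr1 (horner^~ x)).
  by rewrite hornerXn hornerD hornerM (rootP rp) mulr0 add0r.
have sq j : (size (q j) <= (size p).-1)%N.
  have np : p != 0 by apply: monic_neq0.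
  have lt_pred a b : (a < b)%N -> (a <= b.-1)%N by case: b.
  exact/lt_pred/Pdiv.Ring.ltn_rmodpN0.
have [i [j [ij e]]] := @pigeonhole _ (enum {poly_((size p).-1) 'F_2})
  (fun j => npolyp _ (q j)) (fun j => mem_enum _ _).
have {}e : q i = q j by rewrite -(npolypK (sq i)) -(npolypK (sq j)) e.
exists (j - i)%N; split; first by rewrite subn_gt0.
apply: (@frob_inj i); rewrite /= -exprM -expnD subnK 1?ltnW // -!qx e //.
Qed.

Lemma frob_fixed_iter m j (x : k) : x ^+ (2 ^ m) = x -> x ^+ (2 ^ (m * j)) = x.
Proof.
move=> e; elim: j => [|j IH]; first by rewrite muln0 expr1.
by rewrite mulnS expnD exprM e.
Qed.

Lemma frob_fixed_seq (s : seq k) : exists m, (0 < m)%N /\ {in s, forall x, x ^+ (2 ^ m) = x}.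
Proof.
elim: s => [|x s [m [m0 h]]]; first by exists 1%N.
have [j [j0 e]] := frob_fixed x; exists (j * m)%N; rewrite muln_gt0 j0; split=> // y.
rewrite inE => /predU1P [->|ys]; first exact: frob_fixed_iter.
by rewrite mulnC; apply: frob_fixed_iter; exact: h.
Qed.

Section Finite.
Variables (W : weierstrass k) (m : nat).
(** Membership in the finite subfield of elements fixed by the m-th power of
    Frobenius; [fixc] says that a point has its coordinates there. *)
Definition fixf (x : k) := x ^+ (2 ^ m) == x.
Definition fixc (p : option (k * k)) := if p is Some (x, y) then fixf x && fixf y else true.

Lemma fixfD x y : fixf x -> fixf y -> fixf (x + y).
Proof. by rewrite /fixf frobD => /eqP -> /eqP ->. Qed.
Lemma fixfM x y : fixf x -> fixf y -> fixf (x * y).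
Proof. by rewrite /fixf exprMn => /eqP -> /eqP ->. Qed.
Lemma fixfV x : fixf x -> fixf x^-1.
Proof. by rewrite /fixf exprVn => /eqP ->. Qed.
Lemma fixfN x : fixf x -> fixf (- x).
Proof.
rewrite /fixf => /eqP e; have := frobD m (- x) x; rewrite addNr frob0 e => /esym/eqP.
by rewrite addr_eq0.
Qed.
Lemma fixf1 : fixf 1. Proof. by rewrite /fixf expr1n. Qed.
Lemma fixfn n : fixf n%:R.
Proof. by elim: n => [|n IH]; rewrite ?mulrS ?fixfD ?fixf1 // /fixf frob0. Qed.
Lemma fixfX x n : fixf x -> fixf (x ^+ n).
Proof. by move=> hx; elim: n => [|n IH]; rewrite ?exprS ?fixfM ?fixf1. Qed.

Hypothesis fixW : [&& fixf (a1 W), fixf (a2 W), fixf (a3 W), fixf (a4 W) & fixf (a6 W)].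

Ltac fixtac := repeat first [assumption | apply: fixfn | apply: fixfD | apply: fixfM | apply: fixfN
  | apply: fixfV | apply: fixfX].

Lemma fixc_add p q : fixc p -> fixc q -> fixc (add_coords W p q).
Proof.
have /and5P [f1 f2 f3 f4 f6] := fixW.
case: p => [[x1 y1]|] //; case: q => [[x2 y2]|] // /andP [h1 h2] /andP [h3 h4].
rewrite /add_coords; case: ifP => // _.
have hl : fixf (chord_slope W x1 y1 x2 y2).
  by rewrite /chord_slope; case: ifP => _; fixtac.
by move: hl; move: (chord_slope _ _ _ _ _) => l hl; apply/andP; split; fixtac.
Qed.
End Finite.

(** All multiples of P have coordinates in a common finite field. *)
Lemma torsion (E : ellcurve k) (P : point E) : exists n, (0 < n)%N /\ P *+ n = 0.
Proof.
pose cs := if coords P is Some (x, y) then [:: x; y] else [::].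
have [m [m0 h]] := frob_fixed_seq ([:: a1 E; a2 E; a3 E; a4 E; a6 E] ++ cs).
have fW : [&& fixf m (a1 E), fixf m (a2 E), fixf m (a3 E), fixf m (a4 E) & fixf m (a6 E)].
  by apply/and5P; split; apply/eqP; apply: h; rewrite !inE eqxx ?orbT.
have fP : fixc m (coords P).
  move: h; rewrite /cs; case: (coords P) => [[x y]|] // h.
  by apply/andP; split; apply/eqP; apply: h; rewrite !inE eqxx ?orbT.
have fn n : fixc m (coords (P *+ n)).
  elim: n => // n IH; rewrite mulrS; exact: fixc_add.
have [rs ers] := closed_field_poly_normal ('X ^+ (2 ^ m) - 'X : {poly k}).
have nz : ('X ^+ (2 ^ m) - 'X : {poly k}) != 0.
  have m1 : (1 < 2 ^ m)%N by case: (m) m0 => // j _; rewrite expnS; have := expn_gt0 2 j; lia.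
  by rewrite -size_poly_gt0 size_polyDl ?size_polyXn // size_polyN size_polyX ltnS.
have rsP x : fixf m x -> x \in rs.
  move=> /eqP e; rewrite -root_prod_XsubC; have : root ('X ^+ (2 ^ m) - 'X) x.
    by rewrite rootE !hornerE e subrr.
  by rewrite ers rootZ // lead_coef_eq0.
have hS n : coords (P *+ n) \in None :: [seq Some (x, y) | x <- rs, y <- rs].
  have := fn n; rewrite inE; case: (coords _) => [[x y]|] //= /andP [fx fy].
  by apply/allpairsP; exists (x, y); rewrite !rsP.
have [i [j [ij e]]] := pigeonhole hS.
exists (j - i)%N; rewrite subn_gt0; split=> //.
by apply: (addrI (P *+ i)); rewrite -mulrnDr subnKC 1?ltnW // addr0; apply/val_inj/esym.
Qed.

End Torsion.

(** * Lame points in characteristic 2 *)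

Lemma mulrb_nat (x : int) (b : bool) : x *+ b = x * (b : nat)%:Z.
Proof. by case: b; rewrite ?mulr1 ?mulr0. Qed.

Section Transfer.
Variables (k : fieldType) (W : weierstrass k).
Local Notation K := (funfield_model W).
Implicit Types (R : point W) (f : K).

Lemma eval_funE R p : eval_fun R p = evfun K R p.
Proof. by rewrite /eval_fun /evfun /eval2 /chart /loc_fun; case: (coords R). Qed.

Lemma has_valueE R f c : has_value R f c <-> hasv R f c.
Proof.
by split=> -[p [q [h1 h2 h3]]]; exists p, q; split; rewrite // ?eval_funE // -?eval_funE.
Qed.

Lemma uniformizerE R f : uniformizer R f <-> unif R f.
Proof.
split=> -[h1 h2]; split.
- exact: ((has_valueE R f 0).1 h1).
- move=> g hg; have [h [c [hv e]]] := h2 g ((has_valueE R g 0).2 hg).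
  by exists h, c; split; [exact: ((has_valueE R h c).1 hv) | exact: e].
- exact: ((has_valueE R f 0).2 h1).
- move=> g hg; have [h [c [hv e]]] := h2 g ((has_valueE R g 0).1 hg).
  by exists h, c; split; [exact: ((has_valueE R h c).2 hv) | exact: e].
Qed.

Lemma has_ordE R f m : has_ord R f m <-> hord R f m.
Proof.
split=> -[t [u [c [h1 h2 h3 h4]]]]; exists t, u, c; split.
- exact: ((uniformizerE R t).1 h1).
- exact: ((has_valueE R u c).1 h2).
- exact: h3.
- exact: h4.
- exact: ((uniformizerE R t).2 h1).
- exact: ((has_valueE R u c).2 h2).
- exact: h3.
- exact: h4.
Qed.

Lemma ram_indexE R f e : ram_index f R e <-> ramidx f R e.
Proof.
split=> -[[c hc h]|[hc h]].
- by left; exists c; [exact: ((has_valueE R f c).1 hc)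
    | exact: ((has_ordE R (f - cstfun K c) e).1 h)].
- by right; split; [exact: ((has_valueE R f^-1 0).1 hc)
    | exact: ((has_ordE R f^-1 e).1 h)].
- by left; exists c; [exact: ((has_valueE R f c).2 hc)
    | exact: ((has_ordE R (f - cstfun K c) e).2 h)].
- by right; split; [exact: ((has_valueE R f^-1 0).2 hc)
    | exact: ((has_ordE R f^-1 e).2 h)].
Qed.

Lemma ramifiedE R f : ramified f R <-> is_ramified f R.
Proof.
split=> -[e e1 h]; exists e; try exact: e1.
- exact: ((ram_indexE R f e).1 h).
- exact: ((ram_indexE R f e).2 h).
Qed.
End Transfer.

Section Lame.
Variables (k : closedFieldType) (E : ellcurve k).
Local Notation K := (funfield_model E).
Hypothesis char2 : 2%N \in [pchar k].
Implicit Types P Q R : point E.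

Lemma two0 : 2%:R = 0 :> k. Proof. exact: pcharf0 char2. Qed.
Lemma pchar_eq2 p : p \in [pchar k] -> p = 2%N.
Proof. by rewrite (pcharf_eq char2) => /eqP. Qed.

Lemma exact_orderE P n : exact_order P n <->
  [/\ (0 < n)%N, P *+ n = 0 & forall m, (0 < m < n)%N -> P *+ m <> 0].
Proof.
by split=> -[n0 e h]; split; rewrite ?mul_ptE // in e *; move=> m /h; rewrite mul_ptE.
Qed.

Lemma exact_order_exists P n : (0 < n)%N -> P *+ n = 0 -> exists m, exact_order P m.
Proof.
move=> n0 e; have ex : exists m, (0 < m)%N && (P *+ m == 0).
  by exists n; rewrite n0 e eqxx.
case: (ex_minnP ex) => m /andP [m0 /eqP em] mn; exists m; apply/exact_orderE; split=> //.
by move=> j /andP [j0 jm] ej; have := mn j; rewrite j0 ej eqxx leqNgt jm => /(_ isT).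
Qed.

(** In characteristic 2 the point of order 2, when there is one, has abscissa
    a3 / a1. *)
Lemma supersingularE : supersingular E <-> a1 E = 0.
Proof.
split=> [[p /pchar_eq2 -> h]|a10]; last first.
  by exists 2%N => // P; rewrite mul_ptE mulr2n; exact: (two_torsion_ss two0 a10).
apply/eqP; apply: contraT => /(two_torsion_ordinary two0) [T T0 tor].
by case: T0; apply: h; rewrite mul_ptE mulr2n; apply/eqP; rewrite tor eqxx orbT.
Qed.

Lemma odd_exact_order P n : a1 E = 0 -> exact_order P n -> odd n.
Proof.
move=> a10 /exact_orderE [n0 e h]; apply: contraT => on.
have en : n = (n./2 + n./2)%N by rewrite addnn -[LHS]odd_double_half (negPf on).
have := h n./2; case; first by rewrite {3}en; lia.
by apply: (two_torsion_ss two0 a10); rewrite -mulrnDr -en.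
Qed.

Lemma lame_triple_a1 P n Q : lame_triple P n Q -> a1 E = 0.
Proof.
move=> [n1 /exact_orderE [n0 Pn Pmin] ndvd [_ _]].
move=> [f [hdf _ ram [_ _ /ram_indexE ramQ]]].
have on : odd n by have := ndvd 2%N char2; rewrite dvdn2 negbK.
have P0 : P <> 0 by move=> e; apply: (Pmin 1%N) => //; rewrite e mul0rn.
apply/eqP; apply: contraT => na; exfalso.
have hf : hdiv (K := K) f (fun R => n%:Z * dirac P R - n%:Z * dirac (pt0 E) R).
  move=> R; apply: hord_eq ((has_ordE R f _).1 (hdf R)).
  by rewrite /dirac !mulrb_nat.
apply: (no_lame_ordinary two0 na on P0 Pn hf _ ramQ) => R /(ramifiedE R f).2.
exact: (ram R).1.
Qed.

Lemma half_order P n : exact_order P n -> odd n -> exact_order (P *+ n.+1./2) n.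
Proof.
move=> /exact_orderE [n0 Pn Pmin] on; apply/exact_orderE; split=> //.
  by rewrite -mulrnA mulnC mulrnA Pn mul0rn.
move=> m /Pmin hm e; apply: hm.
by rewrite -[P](half_point on Pn) mulrnDl e addr0.
Qed.

Lemma lame_triple_ss P n : a1 E = 0 -> P <> 0 -> exact_order P n ->
  lame_triple P n (P *+ n.+1./2).
Proof.
move=> a10 P0 ordP; have on := odd_exact_order a10 ordP.
have /exact_orderE [n0 Pn Pmin] := ordP.
have n1 : (1 < n)%N.
  by rewrite ltn_neqAle n0 andbT; apply/eqP => en; move: Pn; rewrite -en.
have hQ : n.+1./2 = (n./2).+1 by rewrite -[LHS]/(uphalf n) uphalf_half on.
have Q0' : P *+ n.+1./2 <> 0 by rewrite hQ; exact: (half_neq0 P0 on Pn).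
have QP' : P *+ n.+1./2 <> P by rewrite hQ; exact: (half_neq P0 on Pn).
have [f [hf h1 r0 rP rQ]] := lame_function_exists K two0 a10 P0 on Pn.
rewrite -hQ in h1 rQ.
have idx R e : ram_index (f : funfield E) R e -> [\/ e = n, e = 3%N | e = 1%N].
  move=> /(ram_indexE R f e).1 h.
  case: (h1 R) => [[eR|eR|eR]|hR]; first 3 last.
  - by constructor 3; exact: ramidx_uniq h hR.
  - by rewrite eR in h; constructor 1; exact: ramidx_uniq h r0.
  - by rewrite eR in h; constructor 1; exact: ramidx_uniq h rP.
  - by rewrite eR in h; constructor 2; exact: ramidx_uniq h rQ.
have i0 : ram_index (f : funfield E) (pt0 E) n := (ram_indexE (pt0 E) f n).2 r0.
have iP : ram_index (f : funfield E) P n := (ram_indexE P f n).2 rP.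
have iQ : ram_index (f : funfield E) (P *+ n.+1./2) 3 :=
  (ram_indexE (P *+ n.+1./2) f 3%N).2 rQ.
split=> //; first by move=> p /pchar_eq2 ->; rewrite dvdn2 on.
exists f; split.
- move=> R; apply: ((has_ordE R f _).2 _); apply: hord_eq (hf R).
  by rewrite /dirac !mulrb_nat.
- by move=> R e p /idx + /pchar_eq2 ->; rewrite dvdn2 => -[->|->|->]; rewrite ?on.
- move=> R; split=> [[e e1 h]|].
    case: (h1 R) => // hR; have e2 := ramidx_uniq ((ram_indexE R f e).1 h) hR.
    by rewrite e2 in e1.
  by case=> ->; [exists n; [exact: n1 | exact: i0] | exists n; [exact: n1 | exact: iP]
    | exists 3%N; [exact: isT | exact: iQ]].
- by split; [exact: i0 | exact: iP | exact: iQ].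
Qed.

Lemma lame_signature_ss P s : a1 E = 0 -> lame_point P ->
  lame_signature P s <-> s = 1%N.
Proof.
move=> a10 [n [Q [n1 ordP _ _ _]]].
have P0 : P <> 0.
  move=> e; have /exact_orderE [_ _ h] := ordP.
  by apply: (h 1%N); rewrite // e mul0rn.
split=> [[n' [Q' [_ [[//] | [_ oQ]]]]]|->].
  by have := odd_exact_order a10 oQ; rewrite oddM.
exists n, (P *+ n.+1./2); split; first exact: lame_triple_ss.
by left; split=> //; apply: half_order ordP (odd_exact_order a10 ordP).
Qed.

End Lame.

Theorem theorem2p2 (k : closedFieldType) (iota : {rmorphism 'F_2 -> k})
  (k_algebraic : integralRange iota) (E : ellcurve k) :
  [/\ (exists P : point E, lame_point P) <->
        (forall P : point E, P <> pt0 E -> lame_point P),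
      (forall P : point E, P <> pt0 E -> lame_point P) <-> supersingular E
    & (exists P : point E, lame_point P) \/
        (forall P : point E, P <> pt0 E -> lame_point P) ->
      forall P : point E, lame_point P ->
      forall s : nat, lame_signature P s <-> s = 1%N].
Proof.
have char2 := pchar2 iota.
have lame_a1 : (exists P : point E, lame_point P) -> a1 E = 0.
  by move=> [P [n [Q h]]]; exact: (lame_triple_a1 char2 h).
have a1_lame : a1 E = 0 -> forall P : point E, P <> pt0 E -> lame_point P.
  move=> a10 P P0; have [n [n0 Pn]] := torsion k_algebraic P.
  have [m hm] := exact_order_exists n0 Pn.
  by exists m, (P *+ m.+1./2); exact: (lame_triple_ss char2 a10 P0 hm).
have all_ex : (forall P : point E, P <> pt0 E -> lame_point P) ->
    exists P : point E, lame_point P.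
  by move=> h; have [P [P0 _]] := point_above E 0; exists P; exact: h.
split.
- by split=> [/lame_a1|]; [exact: a1_lame | exact: all_ex].
- split=> [/all_ex/lame_a1 a10|/(supersingularE E char2).1]; last exact: a1_lame.
  exact: (supersingularE E char2).2.
- move=> _ P hP s; apply: (lame_signature_ss char2) => //.
  by apply: lame_a1; exists P.
Qed.
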